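(* Let $G$ be a group acting by automorphisms on an abelian group $A$, where $G$, $A$ and the action of $G$ on $A$ are $\emptyset$-definable in a first-order structure $\mathcal G$. Let $B\subset\mathcal G$ be a finite parameter set and let $h\colon G\times G\to A$ be a 2-cocycle which is $B$-definable in $\mathcal G$ and has finite image $\mathrm{Im}(h)\subseteq\mathrm{dcl}(B)$. Let $A_0\le A$ be the subgroup generated by $\mathrm{Im}(h)$. Let $\mathcal G^*\succ\mathcal G$ be a monster model, and let $A_1^*$ be a bounded index subgroup of $A^*$ which is type-definable over $B$ and invariant under the action of $G^*$. Let $\widetilde{G}$ be the extension of $G$ by $A$ defined by $h$ and $\widetilde{G^*}$ its interpretation in $\mathcal G^*$. Assume that: (i) the induced 2-cocycle $\overline{h^*}_{|{G^*}^{00}_B\times{G^*}^{00}_B}\colon{G^*}^{00}_B\times{G^*}^{00}_B\to A_0/(A_1^*\cap A_0)$ is non-split via $B$-invariant functions; (ii) $A_0/(A_1^*\cap A_0)$ is torsion free (and so isomorphic with $\mathbb Z^n$ for some natural $n$). Then $\widetilde{G^*}^{000}_B\neq\widetilde{G^*}^{00}_B$. Suppose furthermore that ${G^*}^{000}_B=G^*$, and that for every proper subgroup $H$ of $A^*$ of bounded index which is type-definable over $B$ in $\mathcal G^*$ and invariant under the action of $G^*$, the induced 2-cocycle $\overline{h^*}\colon G^*\times G^*\to A_0/(H\cap A_0)$ is non-split via $B$-invariant functions. Then $\widetilde{G^*}^{00}_B=\widetilde{G^*}$.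
   Context: Cocycles. If a group $G$ acts by automorphisms on an abelian group $A$ (written additively), a 2-cocycle is a map $h\colon G\times G\to A$ with $h(g_1,g_2)+h(g_1g_2,g_3)=h(g_1,g_2g_3)+g_1\cdot h(g_2,g_3)$ and $h(g,e)=h(e,g)=0$ for all $g,g_1,g_2,g_3\in G$. It defines the extension $\widetilde G=A\times G$ with product $(a_1,g_1)*(a_2,g_2)=(a_1+g_1\cdot a_2+h(g_1,g_2),\,g_1g_2)$. The 2-cocycle $h$ is split via $f\colon G\to A$ if $f(e)=0$ and $h(g_1,g_2)=f(g_1)+g_1\cdot f(g_2)-f(g_1g_2)$ for all $g_1,g_2\in G$. It is non-split via $B$-invariant functions if it is split via no $B$-invariant function. Model theory. A monster model $\mathcal G^*\succ\mathcal G$ is a $\kappa$-saturated, strongly $\kappa$-homogeneous elementary extension for a sufficiently large cardinal $\kappa$; ''small'' and ''bounded'' mean of cardinality $<\kappa$. For an object $X$ definable in $\mathcal G$, $X^*$ denotes its interpretation in $\mathcal G^*$. ''$B$-invariant'' means invariant under $\mathrm{Aut}(\mathcal G^*/B)$. For a group $K$ definable over $B$ in $\mathcal G^*$: $K^{00}_B$ is the smallest subgroup of $K$ of bounded index which is type-definable over $B$, and $K^{000}_B$ is the smallest $B$-invariant subgroup of $K$ of bounded index. Induced cocycles. In the setting of the claim $h^*$ has image $\mathrm{Im}(h)\subseteq A_0$, the group $A_0$ is invariant under the action of $G^*$, and ${G^*}^{00}_B$ acts trivially on $A_0$. For a $G^*$-invariant subgroup $H\le A^*$, the induced 2-cocycle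 $\overline{h^*}\colon G^*\times G^*\to A_0/(H\cap A_0)$ is the composition of $h^*$ with the quotient map $A_0\to A_0/(H\cap A_0)$, with respect to the induced action of $G^*$; in (i), $H=A_1^*$ and $\overline{h^*}$ is restricted to ${G^*}^{00}_B$. *)

(* Defs.v *)
From HB Require Import structures.
From mathcomp Require Import all_boot all_algebra.
From mathcomp Require Import boolp classical_sets functions cardinality.

Set Implicit Arguments.
Unset Strict Implicit.
Unset Printing Implicit Defensive.

Import GRing.Theory.
Local Open Scope classical_set_scope.

Definition tup (T : Type) (n : nat) : Type := 'I_n -> T.

Definition tcat (T : Type) (m n : nat) (u : tup T m) (v : tup T n) :
    tup T (m + n) :=
  fun i => match fintype.split i with inl a => u a | inr b => v b end.

Record language := Language {
  fsym : Type;
  farity : fsym -> nat;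
  rsym : Type;
  rarity : rsym -> nat }.

Record structure (L : language) := Structure {
  carrier :> Type;
  fint : forall f : fsym L, tup carrier (farity f) -> carrier;
  rint : forall r : rsym L, tup carrier (rarity r) -> Prop }.

(* Free variables are numbered 0, ..., n - 1; the variable bound by [All] is
   the last one of the formula in its scope. *)
Inductive term (L : language) (n : nat) : Type :=
  | Var of 'I_n
  | App (f : fsym L) of ('I_(farity f) -> term L n).

Inductive formula (L : language) (n : nat) : Type :=
  | Bot
  | Eq of term L n & term L n
  | Rel (r : rsym L) of ('I_(rarity r) -> term L n)
  | Imp of formula L n & formula L n
  | All of formula L (n + 1).

Fixpoint eval (L : language) (M : structure L) (n : nat) (e : tup M n)
    (t : term L n) : M :=
  match t with
  | Var i => e i
  | App f ts => @fint L M f (fun i => eval e (ts i))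
  end.

Fixpoint sat (L : language) (M : structure L) (n : nat) (p : formula L n) :
    tup M n -> Prop :=
  match p with
  | Bot => fun _ => False
  | Eq s t => fun e => eval e s = eval e t
  | Rel r ts => fun e => @rint L M r (fun i => eval e (ts i))
  | Imp p q => fun e => sat p e -> sat q e
  | All p => fun e => forall x : M, sat p (tcat e (fun _ : 'I_1 => x))
  end.

Definition elementary_on (L : language) (M N : structure L) (C : set M)
    (f : M -> N) : Prop :=
  forall (n : nat) (p : formula L n) (e : tup M n),
    (forall i, C (e i)) -> (sat p e <-> sat p (f \o e : tup N n)).

Definition elementary (L : language) (M N : structure L) (j : M -> N) : Prop :=
  elementary_on setT j.

Definition automorphism (L : language) (N : structure L) (s : N -> N) : Prop :=
  [/\ bijective s,
      forall (f : fsym L) (x : tup N (farity f)),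
        s (fint x) = fint (s \o x : tup N (farity f))
    & forall (r : rsym L) (x : tup N (rarity r)),
        rint x <-> rint (s \o x : tup N (rarity r))].

Definition aut_fixing (L : language) (N : structure L) (C : set N) :
    set (N -> N) :=
  [set s | automorphism s /\ forall b, C b -> s b = b].

(* A formula with parameters from [M]; it can be realised in [M] and in every
   structure into which [M] is mapped. *)
Record pformula (L : language) (M : structure L) (n : nat) := PFormula {
  nparam : nat;
  body : formula L (n + nparam);
  param : tup M nparam }.
Arguments param {L M n} p i.

Definition over (L : language) (M : structure L) (B : set M) (n : nat)
    (D : pformula M n) : Prop :=
  forall i, B (param D i).

Definition realise (L : language) (M N : structure L) (j : M -> N) (n : nat)
    (D : pformula M n) : set (tup N n) :=
  [set t | sat (body D) (tcat t (j \o param D))].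

Definition definable (L : language) (N : structure L) (C : set N) (n : nat) :
    set (set (tup N n)) :=
  [set X | exists2 D : pformula N n, over C D & X = realise id D].

(* [X] is [B]-definable in [M] and [Y] is its interpretation in [N]; when [j]
   is elementary, [Y] depends only on [X]. *)
Definition interpreted (L : language) (M N : structure L) (j : M -> N)
    (B : set M) (n : nat) (X : set (tup M n)) (Y : set (tup N n)) : Prop :=
  exists2 D : pformula M n, over B D & X = realise id D /\ Y = realise j D.

Definition dcl (L : language) (M : structure L) (B : set M) (n : nat) :
    set (tup M n) :=
  [set t | definable B [set t]].

Definition type_definable (L : language) (N : structure L) (C : set N)
    (n : nat) (X : set (tup N n)) : Prop :=
  exists2 F : set (set (tup N n)),
    F `<=` definable C (n := n) & X = \bigcap_(Y in F) Y.

Definition invariant (L : language) (N : structure L) (C : set N) (n : nat)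
    (X : set (tup N n)) : Prop :=
  forall s, aut_fixing C s -> [set (s \o t : tup N n) | t in X] = X.

(* A cardinal is represented by a type [K] of that cardinality. *)
Definition small (K : Type) (T : Type) (X : set T) : Prop :=
  ~ ([set: K] #<= X)%card.

(* Types over [C] are given by the [C]-definable sets of their formulas. *)
Definition saturated (K : Type) (L : language) (N : structure L) : Prop :=
  forall (C : set N) (n : nat) (p : set (set (tup N n))),
    small K C -> p `<=` definable C (n := n) ->
    (forall q : set (set (tup N n)), q `<=` p -> finite_set q ->
       (\bigcap_(X in q) X) !=set0) ->
    (\bigcap_(X in p) X) !=set0.

Definition strongly_homogeneous (K : Type) (L : language) (N : structure L) :
    Prop :=
  forall (C : set N) (f : N -> N), small K C -> elementary_on C f ->
    exists2 s, automorphism s & forall x, C x -> s x = f x.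

(* The cardinal is "sufficiently large" when it exceeds 2^(|L| + aleph_0), an
   upper bound for the number of types over a finite set or over a model of
   size |L| + aleph_0. *)
Definition monster (K : Type) (L : language) (N : structure L) : Prop :=
  [/\ small K [set: set (fsym L + rsym L + nat)%type],
      saturated K N & strongly_homogeneous K N].

Definition subgroup (G : groupType) (S : set G) : Prop :=
  [/\ S 1%g, forall x y, S x -> S y -> S (x * y)%g
    & forall x, S x -> S (x^-1)%g].

Definition bounded_index (K : Type) (G : groupType) (S : set G) : Prop :=
  small K (range (fun x : G => [set (x * y)%g | y in S])).

(* In the next two definitions the underlying set of [G] is identified with a
   set of tuples by [i]. *)
Definition comp00 (K : Type) (L : language) (N : structure L) (C : set N)
    (G : groupType) (n : nat) (i : G -> tup N n) : set G :=
  smallest (fun S => [/\ subgroup S, bounded_index K S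
                       & type_definable C (i @` S)]) set0.

Definition comp000 (K : Type) (L : language) (N : structure L) (C : set N)
    (G : groupType) (n : nat) (i : G -> tup N n) : set G :=
  smallest (fun S => [/\ subgroup S, bounded_index K S
                       & invariant C (i @` S)]) set0.

Definition add_subgroup (A : zmodType) (S : set A) : Prop :=
  [/\ S 0%R, forall x y, S x -> S y -> S (x + y)%R
    & forall x, S x -> S (- x)%R].

Definition add_bounded_index (K : Type) (A : zmodType) (S : set A) : Prop :=
  small K (range (fun x : A => [set (x + y)%R | y in S])).

Record cocycle_action (G : groupType) (A : zmodType) := CocycleAction {
  act : G -> A -> A;
  act1 : forall a, act 1%g a = a;
  actM : forall g1 g2 a, act (g1 * g2)%g a = act g1 (act g2 a);
  actD : forall g a b, act g (a + b)%R = (act g a + act g b)%R;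
  coc : G -> G -> A;
  coc_eq : forall g1 g2 g3,
    (coc g1 g2 + coc (g1 * g2)%g g3)%R
      = (coc g1 (g2 * g3)%g + act g1 (coc g2 g3))%R;
  cocg1 : forall g, coc g 1%g = 0%R;
  coc1g : forall g, coc 1%g g = 0%R }.

Definition extension (G : groupType) (A : zmodType) (c : cocycle_action G A) :
    Type :=
  (A * G)%type.

Section ExtensionGroup.
Context (G : groupType) (A : zmodType) (c : cocycle_action G A).
Local Open Scope ring_scope.

Definition ext_mul (x y : extension c) : extension c :=
  (x.1 + act c x.2 y.1 + coc c x.2 y.2, (x.2 * y.2)%g).

Definition ext_one : extension c := (0, 1%g).

Definition ext_inv (x : extension c) : extension c :=
  (- act c (x.2)^-1%g x.1 - coc c (x.2)^-1%g x.2, (x.2)^-1%g).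

Lemma act0 g : act c g 0 = 0.
Proof. by apply: (addrI (act c g 0)); rewrite -actD !addr0. Qed.

Lemma actN g a : act c g (- a) = - act c g a.
Proof. by apply/eqP; rewrite -addr_eq0 -actD addNr act0. Qed.

Lemma ext_mulA : associative ext_mul.
Proof.
move=> [a g] [b k] [d l]; rewrite /ext_mul /= mulgA; congr pair.
rewrite !actD actM -!addrA; congr (_ + (_ + _)).
rewrite [RHS]addrCA; congr (_ + _).
by rewrite addrC -coc_eq.
Qed.

Lemma ext_mul1 : left_id ext_one ext_mul.
Proof.
by move=> [a g]; rewrite /ext_mul /= mul1g act1 coc1g add0r addr0.
Qed.

Lemma ext_mulr1 : right_id ext_one ext_mul.
Proof.
by move=> [a g]; rewrite /ext_mul /= mulg1 act0 cocg1 !addr0.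
Qed.

Lemma ext_mulV : left_inverse ext_one ext_inv ext_mul.
Proof.
move=> [a g]; rewrite /ext_mul /ext_inv /= mulVg; congr pair.
by rewrite addrAC subrK addNr.
Qed.

Lemma ext_mulrV : right_inverse ext_one ext_inv ext_mul.
Proof.
move=> [a g]; rewrite /ext_mul /ext_inv /= mulgV; congr pair.
have := coc_eq c g g^-1%g g.
rewrite mulgV mulVg coc1g cocg1 addr0 add0r => ->.
by rewrite actD !actN -actM mulgV act1 addrA subrr add0r addNr.
Qed.

HB.instance Definition _ := Choice.copy (extension c) (A * G)%type.
HB.instance Definition _ := isGroup.Build (extension c)
  ext_mulA ext_mul1 ext_mulr1 ext_mulV ext_mulrV.

End ExtensionGroup.

Definition ext_tup (T : Type) (G : groupType) (A : zmodType)
    (c : cocycle_action G A) (n k : nat) (iG : G -> tup T n)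
    (iA : A -> tup T k) (x : extension c) : tup T (k + n) :=
  tcat (iA x.1) (iG x.2).

Definition op_graph (T X Y Z : Type) (m n k : nat) (iX : X -> tup T m)
    (iY : Y -> tup T n) (iZ : Z -> tup T k) (op : X -> Y -> Z) :
    set (tup T (m + (n + k))) :=
  [set t | exists x y, t = tcat (iX x) (tcat (iY y) (iZ (op x y)))].

(* [G], [A], their group operations and the action of [G] on [A] are
   0-definable in [M], the cocycle is [B]-definable in [M], and the primed data
   are their interpretations in [N]. For elementary [j] the ranges and graphs in
   [N] are determined by those in [M], and they automatically satisfy the laws
   carried by the types of [G'], [A'] and [c']. *)
Definition interpreted_cocycle (L : language) (M N : structure L) (j : M -> N)
    (B : set M) (G G' : groupType) (A A' : zmodType) (n k : nat)
    (iG : G -> tup M n) (iA : A -> tup M k)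
    (iG' : G' -> tup N n) (iA' : A' -> tup N k)
    (c : cocycle_action G A) (c' : cocycle_action G' A') : Prop :=
  [/\ injective iG /\ injective iA, injective iG' /\ injective iA' &
    [/\ interpreted j set0 (range iG) (range iG')
          /\ interpreted j set0 (op_graph iG iG iG (fun x y => (x * y)%g))
                                (op_graph iG' iG' iG' (fun x y => (x * y)%g)),
        interpreted j set0 (range iA) (range iA')
          /\ interpreted j set0 (op_graph iA iA iA (fun x y => (x + y)%R))
                                (op_graph iA' iA' iA' (fun x y => (x + y)%R)),
        interpreted j set0 (op_graph iG iA iA (act c))
                           (op_graph iG' iA' iA' (act c'))
      & interpreted j B (op_graph iG iG iA (coc c))
                        (op_graph iG' iG' iA' (coc c'))]].

Definition coc_image (G : groupType) (A : zmodType) (c : cocycle_action G A) :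
    set A :=
  [set a | exists g1 g2, a = coc c g1 g2].

(* [j X] viewed inside the interpretation [A'] of [A]. *)
Definition lift_set (M N : Type) (j : M -> N) (A A' : Type) (k : nat)
    (iA : A -> tup M k) (iA' : A' -> tup N k) (X : set A) : set A' :=
  [set a' | exists2 a, X a & iA' a' = j \o iA a].

Definition act_invariant (G : groupType) (A : zmodType)
    (c : cocycle_action G A) (H : set A) : Prop :=
  forall g a, H a -> H (act c g a).

(* Elements of the quotient [A0 / (H `&` A0)] are the cosets [qclass A0 H a]
   with [a] in [A0]; the group operations of the quotient are the setwise
   ones. *)
Definition qclass (A : zmodType) (A0 H : set A) (a : A) : set A :=
  [set (a + x)%R | x in H `&` A0].

Definition quotient_set (A : zmodType) (A0 H : set A) : set (set A) :=
  [set qclass A0 H a | a in A0].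

Definition quotient_torsion_free (A : zmodType) (A0 H : set A) : Prop :=
  forall (a : A) (m : nat), A0 a -> (0 < m)%N ->
    qclass A0 H (a *+ m)%R = qclass A0 H 0%R -> qclass A0 H a = qclass A0 H 0%R.

Definition set_add (A : zmodType) (X Y : set A) : set A :=
  [set z | exists x y, [/\ X x, Y y & z = (x + y)%R]].

Definition set_sub (A : zmodType) (X Y : set A) : set A :=
  [set z | exists x y, [/\ X x, Y y & z = (x - y)%R]].

(* The cocycle induced on [Q x Q] with values in [A0 / (H `&` A0)] is split via
   the restriction of [f] to [Q]. *)
Definition split_via (G : groupType) (A : zmodType) (c : cocycle_action G A)
    (Q : set G) (A0 H : set A) (f : G -> set A) : Prop :=
  [/\ forall g, Q g -> quotient_set A0 H (f g),
      f 1%g = qclass A0 H 0%R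
    & forall g1 g2, Q g1 -> Q g2 ->
        qclass A0 H (coc c g1 g2)
          = set_sub (set_add (f g1) (act c g1 @` f g2)) (f (g1 * g2)%g)].

Definition invariant_fun (L : language) (N : structure L) (C : set N)
    (G : groupType) (A : zmodType) (n k : nat) (iG : G -> tup N n)
    (iA : A -> tup N k) (Q : set G) (f : G -> set A) : Prop :=
  forall s, aut_fixing C s -> forall g g', Q g -> Q g' -> iG g' = s \o iG g ->
    iA @` f g' = [set (s \o t : tup N k) | t in iA @` f g].

Definition nonsplit (L : language) (N : structure L) (C : set N)
    (G : groupType) (A : zmodType) (n k : nat) (iG : G -> tup N n)
    (iA : A -> tup N k) (c : cocycle_action G A) (Q : set G) (A0 H : set A) :
    Prop :=
  ~ exists2 f : G -> set A, invariant_fun C iG iA Q f & split_via c Q A0 H f.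

(* Main.v *)
Require Import Defs.
From mathcomp Require Import all_boot all_algebra.
From mathcomp Require Import boolp classical_sets functions cardinality.

(** Notation: [Q] is the 00-component of [G'], [E] the extension of [G'] by [A'],
    [D] its 00-component, and [P] the fibre of [D] over [1], a subgroup of [A'].

    Suppose first that the two components of [E] coincide. The group
    [(A1 + A0) x Q] contains [D]: it is a subgroup because [A0] contains the values
    of the cocycle and is stable under the action; its index is bounded; and it is
    invariant because the elements of [A0] are fixed by all automorphisms over the
    parameters. Hence the type-definable group [P] lies in [A1 + A0]. Modulo [A1]
    it becomes a closed countable subgroup of the compact group [A' / A1], so it is
    finite by the Baire category theorem, and trivial because it embeds in the
    torsion-free group [A0 / (A1 & A0)]; this is [torsion_free_countable_cosets].
    On the other hand [D] projects onto [Q], because the projection of a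
    type-definable set is type-definable ([tset_ex], [G00_base]). So, modulo [A1],
    [D] is the graph of a map from [Q] to [(A1 + A0) / A1 = A0 / (A1 & A0)]. This
    map is invariant because [D] is, and its opposite splits the induced cocycle
    ([subgroup_splitting]), against the first assumption.

    Suppose now that [G'] equals its 000-component. Then [D] projects onto [G'],
    so [P], which is normalised by [D], is stable under the action. The
    intersection of [D] with [(P + A0) x G'] is invariant, and its projection to
    [G'] has bounded index; the projection is therefore all of [G']. As before, [D]
    then splits the cocycle modulo [P], by an invariant function. The assumption
    leaves only [P = A'], and then [D = E].

    Both arguments use that the components have bounded index themselves, where
    smallness is strict comparison with a cardinal only known to exceed the number
    of sets of symbols. If [R] is a type-definable bounded equivalence relation, a
    definable set containing [R] covers the sort by finitely many of its sections
    ([bounded_finite_cover]). Recording the sections that contain a point codes its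
    class by a set of symbols, since there are as many formulas as symbols
    ([exists_pairing], [exists_definable_code]), and one code serves a whole family
    of relations ([bounded_equivalence_code]). Codes also pass to extensions, so
    that the rest of the proof needs no cardinal arithmetic ([coded_index]).

    Definability is treated semantically, on types embedded in powers of the
    structure with definable range ([dsort]): the closure properties of definable
    subsets and maps between them are derived once from the syntax and used like a
    first-order calculus. They are proved for pairs of sets interpreted in an
    elementary extension, so that they serve as well to carry the properties of
    the values of the cocycle from [M] to [N]. *)

Local Open Scope classical_set_scope.
Set Implicit Arguments.
Unset Strict Implicit.
Unset Printing Implicit Defensive.

(** * Cardinals *)

Lemma card_leTP (T U : Type) (B : set U) :
  ([set: T] #<= B)%card <-> exists2 f : T -> U, injective f & forall x, B (f x).
Proof.
split=> [|[f fi fB]].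
  move=> /card_leP[f].
  pose i (x : T) : [set: T] := SigSub (mem_set (I : [set: T] x)).
  exists (fun x => val (f (i x))) => [x y /val_inj e|x]; last exact: set_valP.
  have : i x = i y by apply: (@inj _ _ _ f) e; rewrite inE.
  by case.
have [[u Bu]|noB] := pselect (exists u, B u); last first.
  suff -> : [set: T] = set0 by exact: card_ge0.
  by apply/seteqP; split=> // x _; apply: noB; exists (f x).
apply: (@card_le_trans _ _ _ (f @` [set: T])).
  have fi' : {in [set: T] &, injective f} by move=> x y _ _; exact: fi.
  by have := inj_card_eq fi'; rewrite card_eq_sym => /card_eqPle[].
by apply: subset_card_le => _ [x _ <-].
Qed.

Definition partial_injection (U V : Type) (A : set U) (B : set V)
    (r : set (U * V)) : Prop :=
  [/\ forall x y, r (x, y) -> A x /\ B y,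
      forall x y y', r (x, y) -> r (x, y') -> y = y'
    & forall x x' y, r (x, y) -> r (x', y) -> x = x'].

Lemma cardinal_comparability (U V : Type) (A : set U) (B : set V) :
  exists2 r : set (U * V), partial_injection A B r &
    (forall x, A x -> exists y, r (x, y)) \/
    (forall y, B y -> exists x, r (x, y)).
Proof.
have [|r [pr rmax]] := @Zorn_bigcup _ (partial_injection A B).
  move=> F Fp Ftot; split.
  - by move=> x y [r Fr rxy]; have [+ _ _] := Fp _ Fr; apply.
  - move=> x y y' [r Fr rxy] [q Fq qxy].
    have [rq|qr] := Ftot _ _ Fr Fq.
      by have [_ h _] := Fp _ Fq; exact: (h _ _ _ (rq _ rxy) (qxy)).
    by have [_ h _] := Fp _ Fr; exact: (h _ _ _ (rxy) (qr _ qxy)).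
  - move=> x x' y [r Fr rxy] [q Fq qxy].
    have [rq|qr] := Ftot _ _ Fr Fq.
      by have [_ _ h] := Fp _ Fq; exact: (h _ _ _ (rq _ rxy) (qxy)).
    by have [_ _ h] := Fp _ Fr; exact: (h _ _ _ (rxy) (qr _ qxy)).
exists r => //; apply: contrapT => /not_orP[/existsNP[x /not_implyP[Ax nx]]].
move=> /existsNP[y /not_implyP[By ny]].
apply: (rmax (r `|` [set (x, y)])).
  split; first by move=> z; left.
  by move=> /(_ (x, y)) h; apply: nx; exists y; apply: h; right.
have [p1 p2 p3] := pr; split.
- by move=> u v [/p1//|[-> ->]].
- move=> u v v' [ruv|[eu ->]] [ruv'|[eu' ->]] //; first exact: p2 ruv ruv'.
    by subst u; case: nx; exists v.
  by subst u; case: nx; exists v'.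
- move=> u u' v [ruv|[-> ev]] [ruv'|[-> ev']] //; first exact: p3 ruv ruv'.
    by subst v; case: ny; exists u.
  by subst v; case: ny; exists u'.
Qed.

Section Pairing.
Context (T : Type) (e : nat -> T).
Hypothesis e_inj : injective e.

Definition pairing_domain (r : set (T * T * T)) : set T :=
  [set x | exists z, r (x, x, z)].

Local Notation dom := pairing_domain.

Definition partial_pairing (r : set (T * T * T)) : Prop :=
  [/\ forall x y, dom r x -> dom r y -> exists z, r (x, y, z),
      forall x y z, r (x, y, z) -> [/\ dom r x, dom r y & dom r z],
      forall p z z', r (p, z) -> r (p, z') -> z = z'
    & forall p p' z, r (p, z) -> r (p', z) -> p = p'].

(** The pairing of the range of [e] is kept inside the pairings to which the lemma
    of Zorn is applied, so that the domain of a maximal one is infinite. *)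
Definition countable_pairing : set (T * T * T) :=
  [set t | exists a b : nat, t = (e a, e b, e (pickle (a, b)))].

Lemma countable_pairing_dom x : dom countable_pairing x <-> exists a, x = e a.
Proof.
split=> [[z [a [b []]]] -> _ _|[a ->]]; first by exists a.
by exists (e (pickle (a, a))), a, a.
Qed.

Lemma countable_pairingP : partial_pairing countable_pairing.
Proof.
split.
- move=> x y /countable_pairing_dom[a ->] /countable_pairing_dom[b ->].
  by exists (e (pickle (a, b))), a, b.
- move=> x y z [a [b [-> -> ->]]].
  by split; apply/countable_pairing_dom; [exists a|exists b|exists (pickle (a, b))].
- move=> p z z' [a [b [-> ->]]] [a' [b' []]].
  by move=> /e_inj -> /e_inj -> ->.
- move=> p p' z [a [b [-> ->]]] [a' [b' [-> /e_inj]]].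
  by move=> /(pcan_inj pickleK)[-> ->].
Qed.

Lemma partial_pairing_bigcup (F : set (set (T * T * T))) :
  F `<=` partial_pairing -> total_on F subset ->
  partial_pairing (\bigcup_(r in F) r).
Proof.
move=> Fp Ftot.
have sub r x : F r -> dom r x -> dom (\bigcup_(r in F) r) x.
  by move=> Fr [z rz]; exists z, r.
have domS (r q : set (T * T * T)) x : r `<=` q -> dom r x -> dom q x.
  by move=> rq [z /rq qz]; exists z.
split.
- move=> x y [z [r Fr rz]] [z' [q Fq qz]].
  have dx : dom r x by exists z.
  have dy : dom q y by exists z'.
  have [/domS/(_ dx) dx'|/domS/(_ dy) dy'] := Ftot _ _ Fr Fq.
    have [+ _ _ _] := Fp _ Fq => /(_ x y dx' dy)[t qt].
    by exists t, q.
  have [+ _ _ _] := Fp _ Fr => /(_ x y dx dy')[t qt].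
  by exists t, r.
- move=> x y z [r Fr rxyz]; have [_ + _ _] := Fp _ Fr => /(_ _ _ _ rxyz)[dx dy dz].
  by split; apply: sub Fr _.
- move=> p z z' [r Fr rz] [q Fq qz].
  have [rq|qr] := Ftot _ _ Fr Fq.
    by have [_ _ h _] := Fp _ Fq; exact: (h _ _ _ (rq _ rz) (qz)).
  by have [_ _ h _] := Fp _ Fr; exact: (h _ _ _ (rz) (qr _ qz)).
- move=> p p' z [r Fr rz] [q Fq qz].
  have [rq|qr] := Ftot _ _ Fr Fq.
    by have [_ _ _ h] := Fp _ Fq; exact: (h _ _ _ (rq _ rz) (qz)).
  by have [_ _ _ h] := Fp _ Fr; exact: (h _ _ _ (rz) (qr _ qz)).
Qed.

Lemma maximal_pairing : exists r, [/\ partial_pairing r, countable_pairing `<=` r &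
  forall q, r `<` q -> ~ partial_pairing q].
Proof.
have [|r [[pr rb] rmax]] := @Zorn_bigcup _
  (fun r => partial_pairing r /\ (r !=set0 -> countable_pairing `<=` r)).
  move=> F Fp Ftot; split.
    by apply: partial_pairing_bigcup => // r /Fp[].
  by move=> [t [r Fr rt]] u bu; exists r => //; apply: (Fp _ Fr).2 => //; exists t.
have r0 : r !=set0.
  apply: contrapT => r0.
  apply: (rmax countable_pairing); last first.
    by split; [exact: countable_pairingP|move=> _ t].

  split; first by move=> t rt; case: r0; exists t.
  move=> sub; apply: r0; exists (e 0, e 0, e (pickle (0, 0))).
  by apply: sub; exists 0, 0.
exists r; split=> //; first exact: rb.
move=> q rq pq; apply: (rmax q) => //; split=> // _.
exact: subset_trans (rb r0) (properW rq).
Qed.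

(** Zorn's lemma provides a maximal pairing function [r] on a subset [D] of [T].
    If [D] embedded in its complement, with image [g D], the pairing could be
    continued to the union of [D] and [g D]: a pair meeting [g D] is sent to
    the code in [g D] of the pair of base points, tagged with its shape. By
    comparability the complement embeds in [D], so that [T] embeds in [D], and
    the pairing on [D] restricts to one on [T]. *)
Lemma exists_pairing : exists p : T -> T -> T,
  forall x y x' y', p x y = p x' y' -> x = x' /\ y = y'.
Proof.
have [r [[r1 r2 r3 r4] rb rmax]] := maximal_pairing.
have De i : dom r (e i) by exists (e (pickle (i, i))); apply: rb; exists i, i.
have [q Dq] : exists q, forall p : T * T, dom r p.1 -> dom r p.2 -> r (p, q p).
  have /choice[q hq] : forall p : T * T,
      exists z, dom r p.1 -> dom r p.2 -> r (p, z).
    move=> [x y]; have [[dx dy]|nd] := pselect (dom r x /\ dom r y).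
      by have [z rz] := r1 _ _ dx dy; exists z.
    by exists x => /= dx dy; case: nd.
  by exists q.
have qD x y : dom r x -> dom r y -> dom r (q (x, y)).
  by move=> dx dy; have [] := r2 _ _ _ (Dq (x, y) dx dy).
have q_inj x y x' y' : dom r x -> dom r y -> dom r x' -> dom r y' ->
    q (x, y) = q (x', y') -> x = x' /\ y = y'.
  move=> dx dy dx' dy' qe.
  have := Dq (x', y') dx' dy'; rewrite -qe => /(r4 _ _ _ (Dq (x, y) dx dy)).
  by case.
have [s [s1 s2 s3] [sD|sD]] := cardinal_comparability (dom r) (~` dom r); last first.
  have /choice[g gP] : forall x, exists y, ~ dom r x -> s (y, x).
    move=> x; have [dx|dx] := pselect (dom r x); first by exists x.
    by have [y sy] := sD _ dx; exists y.
  pose i x := if `[< dom r x >] then q (x, e 0) else q (g x, e 1).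
  have iD x : dom r (i x).
    rewrite /i; case: asboolP => dx; apply: (qD _ _) => //.
    by have [] := s1 _ _ (gP _ dx).
  have i_inj : injective i.
    move=> x y; rewrite /i; case: asboolP => dx; case: asboolP => dy.
    - by move=> /q_inj[].
    - have [dg _] := s1 _ _ (gP _ dy).
      by move=> /q_inj[] // _ /e_inj.
    - have [dg _] := s1 _ _ (gP _ dx).
      by move=> /q_inj[] // _ /e_inj.
    - have [dgx _] := s1 _ _ (gP _ dx).
      have [dgy _] := s1 _ _ (gP _ dy).
      move=> /q_inj[] // ge _; have := gP _ dy; rewrite -ge.
      exact: s2 (gP _ dx).
  exists (fun x y => q (i x, i y)) => x y x' y' /q_inj[] //.
  by move=> /i_inj -> /i_inj ->.
have /choice[g gP] : forall x, exists y, dom r x -> s (x, y).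
  move=> x; have [dx|dx] := pselect (dom r x); last by exists x.
  by have [y sy] := sD _ dx; exists y.
have gD x : dom r x -> ~ dom r (g x) by move=> /gP/s1[].
have g_inj x y : dom r x -> dom r y -> g x = g y -> x = y.
  by move=> dx dy ge; apply: (s3 _ _ (g y) _ (gP y dy)); rewrite -ge; exact: gP.
have qqD x y i : dom r x -> dom r y -> dom r (q (q (x, y), e i)).
  by move=> dx dy; apply: (qD _ _ (qD _ _ dx dy) (De i)).
pose d (b : bool) x := if b then g x else x.
have d_inj b x b' x' : dom r x -> dom r x' -> d b x = d b' x' -> b = b' /\ x = x'.
  case: b; case: b' => //= dx dx' E.
  - by split=> //; apply: g_inj.
  - by case: (gD _ dx); rewrite E.
  - by case: (gD _ dx'); rewrite -E.
have dF b x : dom r x -> dom r (d b x) -> b = false by case: b => // /gD.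
(* Continuation of the pairing to the union of [D] and [g D]: the shape of a pair,
   tagged by 1, 2 or 3, tells which of its members lie in [g D]. *)
pose ext : set (T * T * T) := [set t | exists (b b' : bool) x y,
   [/\ b || b', dom r x, dom r y &
     t = (d b x, d b' y, g (q (q (x, y), e (b + b'.*2))))]].
have dom_ext b x : dom r x -> dom (r `|` ext) (d b x).
  case: b => /= dx.
    by exists (g (q (q (x, x), e 3))); right; exists true, true, x, x.
  by have [z rz] := r1 _ _ dx dx; exists z; left.
have ext_dom x : dom (r `|` ext) x -> exists b x', dom r x' /\ x = d b x'.
  move=> [z [rz|[b [b' [u [v [_ du dv []]]]]]]]; last first.
    by move=> -> _ _; exists b, u.
  by exists false, x; split=> //; exists z.
exfalso; apply: (rmax (r `|` ext)).
  split; first by move=> t; left.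
  move=> sub.
  have /r2[dg _ _] : r (g (e 0), g (e 0), g (q (q (e 0, e 0), e 3))).
    by apply: sub; right; exists true, true, (e 0), (e 0).
  exact: gD dg.
split.
- move=> x y /ext_dom[b [x' [dx ->]]] /ext_dom[b' [y' [dy ->]]].
  have [bb|nb] := boolP (b || b').
    by exists (g (q (q (x', y'), e (b + b'.*2)))); right; exists b, b', x', y'.
  move: nb; case: b; case: b' => //= _.
  by have [z rz] := r1 _ _ dx dy; exists z; left.
- move=> x y z [/r2[dx dy dz]|[b [b' [u [v [_ du dv [-> -> ->]]]]]]].
    by split; [exact: (dom_ext false)|exact: (dom_ext false)|exact: (dom_ext false)].
  split; try exact: dom_ext.
  by apply: (dom_ext true); exact: qqD.
- move=> [x y] z z' [rz|[b [b' [u [v [bb du dv [ex ey ->]]]]]]]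
     [rz'|[c [c' [u' [v' [cc du' dv' [ex' ey' ->]]]]]]].
  + exact: r3 rz rz'.
  + have [dx dy _] := r2 _ _ _ rz; move: cc; subst x y.
    by rewrite (dF _ _ du' dx) (dF _ _ dv' dy).
  + have [dx dy _] := r2 _ _ _ rz'; move: bb; subst x y.
    by rewrite (dF _ _ du dx) (dF _ _ dv dy).
  + move: ex' ey'; rewrite ex ey.
    by move=> /d_inj[] // -> -> /d_inj[] // -> ->.
- move=> [x y] [x' y'] z [rz|[b [b' [u [v [bb du dv [-> -> ez]]]]]]]
     [rz'|[c [c' [u' [v' [cc du' dv' [-> -> ez']]]]]]].
  + exact: r4 rz rz'.
  + have [_ _ dz] := r2 _ _ _ rz; move: dz; rewrite ez'.
    by move=> dg; case: (gD _ _ dg); exact: qqD.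
  + have [_ _ dz] := r2 _ _ _ rz'; move: dz; rewrite ez.
    by move=> dg; case: (gD _ _ dg); exact: qqD.
  + move: ez'; rewrite ez => /g_inj-/(_ (qqD _ _ _ du dv) (qqD _ _ _ du' dv')).
    move=> /q_inj[]; [exact: qD|exact: De|exact: qD|exact: De|].
    move=> /q_inj[] // -> -> /e_inj.
    by clear ez; case: b bb; case: b'; case: c cc; case: c'.
Qed.

End Pairing.

(** * Renaming of variables and automorphisms *)

Section Tuples.
Context (T : Type).

Lemma tcatl m n (u : tup T m) (v : tup T n) i : tcat u v (lshift n i) = u i.
Proof. by rewrite /tcat (unsplitK (inl i)). Qed.

Lemma tcatr m n (u : tup T m) (v : tup T n) i : tcat u v (rshift m i) = v i.
Proof. by rewrite /tcat (unsplitK (inr i)). Qed.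

Lemma tcat_lshift m n (u : tup T m) (v : tup T n) : tcat u v \o @lshift m n = u.
Proof. by apply/funext => i /=; rewrite tcatl. Qed.

Lemma tcat_rshift m n (u : tup T m) (v : tup T n) : tcat u v \o @rshift m n = v.
Proof. by apply/funext => i /=; rewrite tcatr. Qed.

Lemma tcatK m n (t : tup T (m + n)) :
  tcat (t \o @lshift m n) (t \o @rshift m n) = t.
Proof.
by apply/funext => i; rewrite -[i]splitK; case: (fintype.split i) => a /=;
  rewrite ?tcatl ?tcatr.
Qed.

Lemma tcat_inj m n (u u' : tup T m) (v v' : tup T n) :
  tcat u v = tcat u' v' -> u = u' /\ v = v'.
Proof.
move=> e; split; first by rewrite -(tcat_lshift u v) e tcat_lshift.
by rewrite -(tcat_rshift u v) e tcat_rshift.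
Qed.

Lemma comp_tcat U (f : T -> U) m n (u : tup T m) (v : tup T n) :
  f \o tcat u v = tcat (f \o u) (f \o v).
Proof. by apply/funext => i /=; rewrite /tcat; case: fintype.split. Qed.

End Tuples.

Section Renaming.
Context (L : language).

Fixpoint term_ren m n (f : 'I_m -> 'I_n) (t : term L m) : term L n :=
  match t with
  | Var i => Var L (f i)
  | App g ts => App (fun i => term_ren f (ts i))
  end.

Definition ren_up m n (f : 'I_m -> 'I_n) : 'I_(m + 1) -> 'I_(n + 1) :=
  tcat (@lshift n 1 \o f) (@rshift n 1).

Fixpoint formula_ren m n (f : 'I_m -> 'I_n) (p : formula L m) : formula L n :=
  match p with
  | Bot => Bot L n
  | Eq s t => Eq (term_ren f s) (term_ren f t)
  | Rel r ts => Rel (fun i => term_ren f (ts i))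
  | Imp p q => Imp (formula_ren f p) (formula_ren f q)
  | All p => All (formula_ren (ren_up f) p)
  end.

Lemma eval_ren (M : structure L) m n (f : 'I_m -> 'I_n) (t : term L m)
    (e : tup M n) : eval e (term_ren f t) = eval (e \o f) t.
Proof. by elim: t => [//|g ts IH] /=; congr fint; apply/funext => i. Qed.

Lemma sat_ren (M : structure L) m n (f : 'I_m -> 'I_n) (p : formula L m)
    (e : tup M n) : sat (formula_ren f p) e = sat p (e \o f).
Proof.
elim: p n f e => {m} [m|m s t|m r ts|m p IHp q IHq|m p IH] n f e //=.
- by rewrite !eval_ren.
- by congr rint; apply/funext => i; rewrite eval_ren.
- by rewrite IHp IHq.
- have upE x : tcat e (fun _ : 'I_1 => x) \o ren_up f =
      tcat (e \o f) (fun _ : 'I_1 => x).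
    by rewrite comp_tcat compA tcat_lshift tcat_rshift.
  by apply/propext; split=> h x; have := h x; rewrite IH upE.
Qed.

Lemma eval_automorphism (N : structure L) (s : N -> N) m (e : tup N m)
    (t : term L m) : automorphism s -> eval (s \o e) t = s (eval e t).
Proof.
move=> [_ sf _]; elim: t => [//|g ts IH] /=; rewrite sf; congr fint.
by apply/funext => i /=.
Qed.

Lemma sat_automorphism (N : structure L) (s : N -> N) m (p : formula L m)
    (e : tup N m) : automorphism s -> sat p (s \o e) <-> sat p e.
Proof.
move=> sa; have [[s' sK s'K] _ sr] := sa.
elim: p e => {m} [m|m t t'|m r ts|m p IHp q IHq|m p IH] e //=.
- rewrite !eval_automorphism //; split=> [/(can_inj sK)//|-> //].
- have -> : (fun i => eval (s \o e) (ts i)) = s \o (fun i => eval e (ts i)).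
    by apply/funext => i /=; rewrite eval_automorphism.
  exact: iff_sym (sr _ _).
- by split=> h /IHp/h/IHq.
- have sx x : tcat (s \o e) (fun _ : 'I_1 => s x) =
      s \o tcat e (fun _ : 'I_1 => x) by rewrite comp_tcat.
  split=> h x; first by apply/IH; rewrite -sx; apply: h.
  by rewrite -[x]s'K sx; apply/IH; apply: h.
Qed.

End Renaming.

(** * Sets interpreted in a second structure *)

Section Interpreted.
Context (L : language) (M N : structure L) (j : M -> N).
Implicit Type B : set M.

Lemma interpreted_sub B B' n (X : set (tup M n)) (Y : set (tup N n)) :
  B `<=` B' -> interpreted j B X Y -> interpreted j B' X Y.
Proof. by move=> BB [D oD XY]; exists D => // i; apply: BB. Qed.

(** All closure properties below are proved for a pair of sets defined by the same
    formula in [M] and in [N]. With [N = M] and [j] the identity they are the closure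
    properties of definable sets; with [j] elementary they transfer statements. *)
Lemma interpreted_def B n (r : nat) (p : formula L (n + r)) (b : tup M r)
    (X : set (tup M n)) (Y : set (tup N n)) :
  (forall i, B (b i)) -> (forall t, X t <-> sat p (tcat t b)) ->
  (forall t, Y t <-> sat p (tcat t (j \o b))) -> interpreted j B X Y.
Proof.
move=> Bb hX hY; exists (PFormula p b) => //.
by split; apply/seteqP; split=> t /=; rewrite /realise /= ?hX ?hY.
Qed.

Lemma interpretedP B n (X : set (tup M n)) (Y : set (tup N n)) :
  interpreted j B X Y -> exists r (p : formula L (n + r)) (b : tup M r),
  [/\ forall i, B (b i), forall t, X t <-> sat p (tcat t b)
    & forall t, Y t <-> sat p (tcat t (j \o b))].
Proof. by move=> [[r p b] oD [-> ->]]; exists r, p, b. Qed.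

Lemma interpreted_setT B n : interpreted j B [set: tup M n] [set: tup N n].
Proof.
have b0 T : tup T 0 by case.
apply: (interpreted_def (p := Imp (Bot L (n + 0)) (Bot L (n + 0))) (b := b0 M)).
- by case.
- by move=> t /=; split.
- by move=> t /=; split.
Qed.

Lemma interpreted_setC B n (X : set (tup M n)) (Y : set (tup N n)) :
  interpreted j B X Y -> interpreted j B (~` X) (~` Y).
Proof.
move=> /interpretedP[r [p [b [Bb hX hY]]]].
by apply: (interpreted_def (p := Imp p (Bot L (n + r))) Bb) => t;
  rewrite /setC /mkset ?hX ?hY.
Qed.

Lemma interpreted_setD B n (X X' : set (tup M n)) (Y Y' : set (tup N n)) :
  interpreted j B X Y -> interpreted j B X' Y' ->
  interpreted j B (X `\` X') (Y `\` Y').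
Proof.
move=> /interpretedP[r [p [b [Bb hX hY]]]] /interpretedP[r' [p' [b' [Bb' hX' hY']]]].
pose f := tcat (@lshift n (r + r')) (@rshift n (r + r') \o @lshift r r').
pose f' := tcat (@lshift n (r + r')) (@rshift n (r + r') \o @rshift r r').
have fE T (t : tup T n) (c : tup T r) (c' : tup T r') :
    tcat t (tcat c c') \o f = tcat t c /\ tcat t (tcat c c') \o f' = tcat t c'.
  by rewrite !comp_tcat !compA !tcat_lshift !tcat_rshift tcat_lshift.
pose q := Imp (Imp (formula_ren f p) (formula_ren f' p')) (Bot L (n + (r + r'))).
have qE (P : structure L) (t : tup P n) (c : tup P r) (c' : tup P r') :
    (sat p (tcat t c) /\ ~ sat p' (tcat t c')) <-> sat q (tcat t (tcat c c')).
  rewrite /= !sat_ren; have [-> ->] := fE _ t c c'.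
  by rewrite -not_implyE.
apply: (interpreted_def (p := q) (b := tcat b b')).
- by move=> i; rewrite /tcat; case: fintype.split.
- by move=> t; rewrite -qE /setD /mkset hX hX'.
- by move=> t; rewrite comp_tcat -qE /setD /mkset hY hY'.
Qed.

Lemma interpreted_setI B n (X X' : set (tup M n)) (Y Y' : set (tup N n)) :
  interpreted j B X Y -> interpreted j B X' Y' ->
  interpreted j B (X `&` X') (Y `&` Y').
Proof.
move=> hX hX'; rewrite -(setCK X') -(setCK Y') -!setDE.
by apply: interpreted_setD => //; exact: interpreted_setC.
Qed.

Lemma interpreted_reindex B m n (f : 'I_m -> 'I_n) (X : set (tup M m))
    (Y : set (tup N m)) : interpreted j B X Y ->
  interpreted j B [set t : tup M n | X (t \o f)] [set t : tup N n | Y (t \o f)].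
Proof.
move=> /interpretedP[r [p [b [Bb hX hY]]]].
pose g := tcat (@lshift n r \o f) (@rshift n r).
apply: (interpreted_def (p := formula_ren g p) Bb) => t; rewrite sat_ren.
  by rewrite comp_tcat compA tcat_lshift tcat_rshift -hX.
by rewrite comp_tcat compA tcat_lshift tcat_rshift -hY.
Qed.

Lemma interpreted_param B m n (v : tup M m) (X : set (tup M (n + m)))
    (Y : set (tup N (n + m))) : (forall i, B (v i)) -> interpreted j B X Y ->
  interpreted j B [set t | X (tcat t v)] [set t | Y (tcat t (j \o v))].
Proof.
move=> Bv /interpretedP[r [p [b [Bb hX hY]]]].
pose g := tcat (tcat (@lshift n (m + r)) (@rshift n (m + r) \o @lshift m r))
               (@rshift n (m + r) \o @rshift m r).
have gE T (t : tup T n) (c : tup T m) (c' : tup T r) :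
    tcat t (tcat c c') \o g = tcat (tcat t c) c'.
  by rewrite !comp_tcat !compA !tcat_lshift !tcat_rshift tcat_lshift.
apply: (interpreted_def (p := formula_ren g p) (b := tcat v b)).
- by move=> i; rewrite /tcat; case: fintype.split.
- by move=> t; rewrite sat_ren gE -hX.
- by move=> t; rewrite sat_ren comp_tcat gE -hY.
Qed.

Lemma interpreted_ex1 B n (X : set (tup M (n + 1))) (Y : set (tup N (n + 1))) :
  interpreted j B X Y ->
  interpreted j B [set t | exists x, X (tcat t (fun _ : 'I_1 => x))]
                  [set t | exists x, Y (tcat t (fun _ : 'I_1 => x))].
Proof.
move=> /interpretedP[r [p [b [Bb hX hY]]]].
pose g := tcat (tcat (@lshift (n + r) 1 \o @lshift n r) (@rshift (n + r) 1))
               (@lshift (n + r) 1 \o @rshift n r).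
pose q := Imp (All (Imp (formula_ren g p) (Bot L (n + r + 1)))) (Bot L (n + r)).
have qE (P : structure L) (t : tup P n) (c : tup P r) :
  (exists x, sat p (tcat (tcat t (fun _ : 'I_1 => x)) c)) <-> sat q (tcat t c).
  have gE x : tcat (tcat t c) (fun _ : 'I_1 => x) \o g =
      tcat (tcat t (fun _ : 'I_1 => x)) c.
    by rewrite !comp_tcat !compA !tcat_lshift !tcat_rshift.
  rewrite /=; split=> [[x px] nex|nall].
    by apply: (nex x); rewrite sat_ren gE.
  apply: contrapT => nex; apply: nall => x; rewrite sat_ren gE => px.
  by apply: nex; exists x.
apply: (interpreted_def (p := q) Bb) => t; rewrite -qE.
  by split=> -[x hx]; exists x; apply/hX.
by split=> -[x hx]; exists x; apply/hY.
Qed.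

Lemma interpreted_ex B n k (X : set (tup M (n + k))) (Y : set (tup N (n + k))) :
  interpreted j B X Y ->
  interpreted j B [set t | exists v : tup M k, X (tcat t v)]
                  [set t | exists v : tup N k, Y (tcat t v)].
Proof.
elim: k X Y => [|k IH] X Y hXY.
  have c : tup 'I_n 0 by case.
  have cE T (Z : set (tup T (n + 0))) : [set t : tup T n | Z (t \o tcat id c)] =
      [set t : tup T n | exists v : tup T 0, Z (tcat t v)].
    apply/seteqP; split=> t /=; rewrite comp_tcat; first by exists (t \o c).
    by move=> [v]; have -> // : v = t \o c; apply/funext; case.
  by have := interpreted_reindex (tcat id c) hXY; rewrite !cE.
pose f : 'I_(n + (1 + k)) -> 'I_(n + k + 1) :=
  tcat (@lshift (n + k) 1 \o @lshift n k)
       (tcat (@rshift (n + k) 1) (@lshift (n + k) 1 \o @rshift n k)).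
have fE T (t : tup T n) (v : tup T k) (x : tup T 1) :
    tcat (tcat t v) x \o f = tcat t (tcat x v).
  by rewrite !comp_tcat !compA !tcat_lshift !tcat_rshift.
have := IH _ _ (interpreted_ex1 (interpreted_reindex f hXY)).
have exE T (Z : set (tup T (n + k.+1))) :
  [set t : tup T n | exists v : tup T k, exists x,
     Z (tcat (tcat t v) (fun _ : 'I_1 => x) \o f)] =
  [set t | exists v, Z (tcat t v)].
  apply/seteqP; split=> t [].
    by move=> v [x]; rewrite fE => Zx; exists (tcat (fun _ : 'I_1 => x) v).
  move=> v Zv; exists ((v : tup T (1 + k)) \o @rshift 1 k), (v ord0); rewrite fE.
  have <- // : v = tcat (fun _ : 'I_1 => v ord0) ((v : tup T (1 + k)) \o @rshift 1 k).
  apply: (etrans (esym (@tcatK T 1 k v))); congr (tcat _ _).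
  by apply/funext => i /=; congr v; apply/val_inj; case: i => -[].
by rewrite !exE.
Qed.

End Interpreted.

Section InterpretedMore.
Context (L : language) (M N : structure L) (j : M -> N).
Implicit Type B : set M.

Lemma interpreted_eq B m n (f g : 'I_m -> 'I_n) :
  interpreted j B [set t : tup M n | t \o f = t \o g]
                  [set t : tup N n | t \o f = t \o g].
Proof.
have b0 T : tup T 0 by case.
have step : forall s : seq 'I_m, interpreted j B
    [set t : tup M n | forall i, i \in s -> t (f i) = t (g i)]
    [set t : tup N n | forall i, i \in s -> t (f i) = t (g i)].
  elim=> [|i s IH].
    have E T : [set: tup T n] =
        [set t : tup T n | forall i : 'I_m, i \in [::] -> t (f i) = t (g i)].
      by apply/seteqP.
    by rewrite -!E; exact: interpreted_setT.
  have eqi : interpreted j B [set t : tup M n | t (f i) = t (g i)]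
                             [set t : tup N n | t (f i) = t (g i)].
    by apply: (interpreted_def (b := b0 M)
      (p := Eq (Var L (@lshift n 0 (f i))) (Var L (@lshift n 0 (g i))))) => [|t|t];
      [case|rewrite /= !tcatl|rewrite /= !tcatl].
  have E T : [set t : tup T n | t (f i) = t (g i)] `&`
      [set t : tup T n | forall i, i \in s -> t (f i) = t (g i)] =
      [set t : tup T n | forall j, j \in i :: s -> t (f j) = t (g j)].
    apply/seteqP; split=> t /=.
      by move=> [e h] l; rewrite inE => /predU1P[->|/h].
    by move=> h; split=> [|l ls]; apply: h; rewrite inE ?eqxx // ls orbT.
  by rewrite -!E; exact: interpreted_setI.
have E T : [set t : tup T n | forall i : 'I_m, i \in enum 'I_m -> t (f i) = t (g i)] =
    [set t : tup T n | t \o f = t \o g].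
  apply/seteqP; split=> t /= h; first by apply/funext => i; apply: h; rewrite mem_enum.
  by move=> i _; have := congr1 (@^~ i) h.
by rewrite -!E; exact: step.
Qed.

Lemma interpreted_definable B n (X : set (tup M n)) (Y : set (tup N n)) :
  interpreted j B X Y -> definable (j @` B) Y.
Proof.
move=> [[r p b] oD [_ ->]].
by exists (PFormula p (j \o b)) => // i; exists (b i); [exact: oD|].
Qed.

Hypothesis j_elem : elementary j.

Lemma interpreted_mem B n (X : set (tup M n)) (Y : set (tup N n)) t :
  interpreted j B X Y -> X t <-> Y (j \o t).
Proof.
move=> /interpretedP[r [p [b [_ hX hY]]]]; rewrite hX hY -comp_tcat.
exact: j_elem.
Qed.

Lemma interpreted_nonempty B n (X : set (tup M n)) (Y : set (tup N n)) :
  interpreted j B X Y -> Y !=set0 -> X !=set0.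
Proof.
move=> hXY [y Yy].
have b0 T : tup T 0 by case.
have E T (v : tup T n) : tcat (b0 T) v = v.
  rewrite -[RHS](@tcatK T 0 n v); congr (tcat _ _); first by apply/funext; case.
  by apply/funext => i /=; congr v; apply/val_inj.
have hE := @interpreted_ex _ _ _ j B 0 n X Y hXY.
have [_ [|v Xv]] := interpreted_mem (b0 M) hE; last by exists v; rewrite E in Xv.
by exists y; have -> : j \o b0 M = b0 N; [apply/funext; case|rewrite E].
Qed.

End InterpretedMore.

(** * Definable sets and formulas *)

Section Definable.
Context (L : language) (N : structure L).
Implicit Types C : set N.

Lemma definableP C n (X : set (tup N n)) :
  definable C X <-> interpreted id C X X.
Proof.
by split=> [[D oD XD]|[D oD [XD _]]]; exists D.
Qed.

Lemma definable_sub C C' n (X : set (tup N n)) :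
  C `<=` C' -> definable C X -> definable C' X.
Proof. by move=> CC /definableP /(interpreted_sub CC) /definableP. Qed.

Lemma definable_automorphism C n (X : set (tup N n)) s t :
  aut_fixing C s -> definable C X -> X (s \o t) <-> X t.
Proof.
move=> [sa sC] /definableP /interpretedP[r [p [b [Cb hX _]]]].
rewrite !hX -(sat_automorphism p (tcat t b) sa) comp_tcat.
have -> // : s \o b = b by apply/funext => i /=; exact: sC.
Qed.

End Definable.

Lemma aut_fixing_inv (L : language) (N : structure L) (C : set N) s :
  aut_fixing C s -> exists s', [/\ aut_fixing C s', cancel s s' & cancel s' s].
Proof.
move=> [[[s' sK s'K] sf sr] sC]; exists s'; split=> //; split; last first.
  by move=> b Cb; rewrite -{1}(sC _ Cb) sK.
have s'E m (x : tup N m) : s \o (s' \o x) = x by apply/funext => i /=.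
split; first by exists s.
  by move=> f x; apply: (can_inj sK); rewrite s'K sf s'E.
by move=> r x; rewrite (sr r (s' \o x)) s'E.
Qed.

(** The pairing function turns syntax trees into symbols. The length of a coded tuple
    of arguments is not stored: it is the arity of the head symbol, decoded first. *)
Section Codes.
Context (L : language) (N : structure L).

Definition symbols : Type := (Defs.fsym L + rsym L + nat)%type.

Definition symbol_nat (i : nat) : symbols := inr i.

Context (p : symbols -> symbols -> symbols).
Hypothesis p_inj : forall x y x' y', p x y = p x' y' -> x = x' /\ y = y'.

Definition tuple_code r (u : 'I_r -> symbols) : symbols :=
  foldr (fun i c => p (u i) c) (symbol_nat 0) (enum 'I_r).

Lemma tuple_code_inj r (u v : 'I_r -> symbols) :
  tuple_code u = tuple_code v -> u =1 v.
Proof.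
rewrite /tuple_code => e i; have := mem_enum 'I_r i.
elim: (enum 'I_r) e => [//|l s IH] /= /p_inj[ul us].
by rewrite inE => /predU1P[->|/(IH us)].
Qed.

Fixpoint term_code n (t : term L n) : symbols :=
  match t with
  | Var i => p (symbol_nat 0) (symbol_nat i)
  | App f ts =>
      p (symbol_nat 1) (p (inl (inl f)) (tuple_code (fun i => term_code (ts i))))
  end.

Fixpoint formula_code n (q : formula L n) : symbols :=
  match q with
  | Bot => p (symbol_nat 0) (symbol_nat 0)
  | Eq s t => p (symbol_nat 1) (p (term_code s) (term_code t))
  | Rel r ts =>
      p (symbol_nat 2) (p (inl (inr r)) (tuple_code (fun i => term_code (ts i))))
  | Imp q q' => p (symbol_nat 3) (p (formula_code q) (formula_code q'))
  | All q => p (symbol_nat 4) (formula_code q)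
  end.

Lemma term_code_inj n : injective (@term_code n).
Proof.
elim=> [i|f ts IH] [i'|f' ts'] /= /p_inj[//] _.
  by move=> [/val_inj ->].
move=> /p_inj[[ff]]; subst f' => /tuple_code_inj tt; congr App.
by apply/funext => i; apply: IH; exact: tt.
Qed.

Lemma formula_code_inj n : injective (@formula_code n).
Proof.
elim=> {n} [n|n s t|n r ts|n q IHq q' IHq'|n q IHq]
  [|s1 t1|r1 ts1|q1 q1'|q1] //= /p_inj[//] _.
- by move=> /p_inj[/term_code_inj -> /term_code_inj ->].
- move=> /p_inj[[rr]]; subst r1 => /tuple_code_inj tt; congr Rel.
  by apply/funext => i; apply: term_code_inj; exact: tt.
- by move=> /p_inj[/IHq -> /IHq' ->].
- by move=> /IHq ->.
Qed.

(** The parameters of a definition are finitely many elements of a countable set, so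
    they are coded by symbols as its formula is. *)
Lemma exists_definable_code (C : set N) n : countable C ->
  exists c : set (tup N n) -> symbols, forall X Y,
    definable C X -> definable C Y -> c X = c Y -> X = Y.
Proof.
move=> /countable_injP[g g_inj].
have gC x y : C x -> C y -> g x = g y -> x = y.
  by move=> Cx Cy; apply: g_inj; rewrite inE.
pose dcode (D : pformula N n) : symbols := p (symbol_nat (nparam D))
   (p (formula_code (body D)) (tuple_code (fun i => symbol_nat (g (param D i))))).
have dcode_inj D D' : Defs.over C D -> Defs.over C D' -> dcode D = dcode D' ->
    realise id D = realise id D'.
  case: D => r q b; case: D' => r' q' b' /= Cb Cb'; rewrite /dcode /=.
  move=> /p_inj[[rr]]; subst r' => /p_inj[/formula_code_inj <- /tuple_code_inj bb].
  have -> // : b = b'.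
  by apply/funext => i; apply: gC; [exact: Cb|exact: Cb'|case: (bb i)].
have /choice[d dP] : forall X : set (tup N n), exists c, definable C X ->
    exists D, [/\ Defs.over C D, X = realise id D & c = dcode D].
  move=> X; have [[D oD XD]|nX] := pselect (definable C X).
    by exists (dcode D) => _; exists D.
  by exists (symbol_nat 0) => /nX.
exists d => X Y /dP[D [oD -> ->]] /dP[D' [oD' -> ->]].
exact: dcode_inj.
Qed.

End Codes.

(** * Smallness *)

Section Smallness.
Context (K : Type).

Lemma small_rel (U V : Type) (X : set U) (Y : set V) (r : U -> V -> Prop) :
  (forall x, X x -> exists2 y, Y y & r x y) ->
  (forall x x' y, X x -> X x' -> r x y -> r x' y -> x = x') ->
  small K Y -> small K X.
Proof.
move=> rT rI KY /card_leTP[f f_inj fX]; apply: KY.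
have /choice[g gP] : forall i, exists y, Y y /\ r (f i) y.
  by move=> i; have [y Yy ry] := rT _ (fX i); exists y.
apply/card_leTP; exists g => [i i' e|i]; last by have [] := gP i.
apply: f_inj; apply: (rI _ _ (g i)) => //; first by have [] := gP i.
by rewrite e; have [] := gP i'.
Qed.

Lemma small_fun (U V : Type) (X : set U) (Y : set V) (f : U -> V) :
  (forall x, X x -> Y (f x)) ->
  (forall x x', X x -> X x' -> f x = f x' -> x = x') -> small K Y -> small K X.
Proof.
move=> fXY f_inj; apply: (small_rel (r := fun x y => y = f x)).
  by move=> x Xx; exists (f x) => //; exact: fXY.
by move=> x x' y Xx Xx' -> /f_inj; apply.
Qed.

Lemma small_range (U V W : Type) (c : U -> V) (phi : U -> W) :
  (forall x y, phi x = phi y -> c x = c y) ->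
  small K [set: W] -> small K (range c).
Proof.
move=> phic; apply: (small_rel (r := fun x y => exists2 u, x = c u & y = phi u)).
  by move=> _ [u _ <-]; exists (phi u) => //; exists u.
by move=> _ _ w [u _ <-] [v _ <-] [u' -> ->] [v' -> /phic].
Qed.

End Smallness.

Section MonsterCardinal.
Context (K : Type) (L : language).
Hypothesis small_symbols : small K [set: set (symbols L)].

Lemma small_countable (U : Type) (f : U -> nat) : injective f -> small K [set: U].
Proof.
move=> f_inj.
apply: (small_fun (f := fun x : U => [set symbol_nat L (f x)])) small_symbols => //.
move=> x x' _ _ /seteqP[/(_ (symbol_nat L (f x)) erefl) + _].
by move=> [/f_inj].
Qed.

End MonsterCardinal.

(** * Definable sorts *)

(** A type identified with a definable set of tuples. Products of sorts are sorts,
    so that definable sets and maps can be combined without handling tuples. *)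
Class dsort (L : language) (N : structure L) (C : set N) (X : Type) := DSort {
  sdim : nat;
  emb : X -> tup N sdim;
  emb_inj : injective emb;
  emb_def : definable C (range emb) }.

Section Sorts.
Context (L : language) (N : structure L) (C : set N).
Local Notation sort := (dsort C).

Definition dset (X : Type) {sX : sort X} (P : set X) : Prop :=
  definable C (emb @` P).

Section OneSort.
Context (X : Type) {sX : sort X}.
Implicit Types P Q : set X.

Lemma mem_emb P x : (emb @` P) (emb x) <-> P x.
Proof. by split=> [[y Py e]|Px]; [rewrite -(emb_inj e)|exists x]. Qed.

Lemma dset_iff P Q : (forall x, P x <-> Q x) -> dset P -> dset Q.
Proof. by move=> PQ; have -> : P = Q by apply/seteqP; split=> x /PQ. Qed.

(** The range of the embedding being definable, a definable set of tuples need only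
    agree with a subset of the sort on that range. *)
Lemma dset_trace (Z : set (tup N sdim)) P :
  definable C Z -> (forall x, P x <-> Z (emb x)) -> dset P.
Proof.
move=> Zd PZ; rewrite /dset.
have -> : emb @` P = range emb `&` Z.
  apply/seteqP; split=> [_ [x /PZ Zx <-]|_ [[x _ <-] /PZ Px]]; last by exists x.
  by split=> //; exists x.
apply/definableP; apply: interpreted_setI; first exact/definableP/emb_def.
exact/definableP.
Qed.

Lemma dset_setT : dset [set: X].
Proof. exact: emb_def. Qed.

Lemma dset_setI P Q : dset P -> dset Q -> dset (P `&` Q).
Proof.
move=> /definableP dP /definableP dQ.
have /definableP dPQ := interpreted_setI dP dQ.
by apply: (dset_trace dPQ) => x; rewrite /setI /mkset !mem_emb.
Qed.

Lemma dset_setC P : dset P -> dset (~` P).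
Proof.
move=> /definableP /interpreted_setC /definableP dP; apply: (dset_trace dP) => x.
by rewrite /setC /mkset mem_emb.
Qed.

End OneSort.

Global Instance prod_sort (X Y : Type) (sX : sort X) (sY : sort Y) :
  sort (X * Y)%type.
Proof.
apply: (@DSort _ _ _ _ (@sdim _ _ _ _ sX + @sdim _ _ _ _ sY)
  (fun x => tcat (emb x.1) (emb x.2))).
  by move=> [x y] [x' y'] /= /tcat_inj[ex ey]; rewrite (emb_inj ex) (emb_inj ey).
have /definableP/(interpreted_reindex (@lshift _ _)) dX := @emb_def _ _ _ _ sX.
have /definableP/(interpreted_reindex (@rshift _ _)) dY := @emb_def _ _ _ _ sY.
have /definableP := interpreted_setI (dX (@sdim _ _ _ _ sY)) (dY (@sdim _ _ _ _ sX)).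
congr definable; apply/seteqP; split=> [t [[x _ ex] [y _ ey]]|_ [[x y] _ <-]].
  by exists (x, y) => //=; rewrite ex ey tcatK.
by split; rewrite /= ?tcat_lshift ?tcat_rshift; [exists x|exists y].
Defined.

(** Maps that select and reorder coordinates. Preimages under them are obtained by
    renaming variables, so that definable maps need not be known to compose in order
    to rearrange the factors of a product. *)
Definition coordinate_map (X Y : Type) {sX : sort X} {sY : sort Y} (f : X -> Y) :=
  exists s : 'I_(@sdim _ _ _ _ sY) -> 'I_(@sdim _ _ _ _ sX),
    forall x, emb (f x) = emb x \o s.

Definition dmap (X Y : Type) {sX : sort X} {sY : sort Y} (f : X -> Y) :=
  dset [set p : X * Y | f p.1 = p.2].

Section Maps.
Context (X Y Z : Type) {sX : sort X} {sY : sort Y} {sZ : sort Z}.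

Lemma coord_id : coordinate_map (fun x : X => x).
Proof. by exists id. Qed.

Lemma coord_comp (f : X -> Y) (g : Y -> Z) :
  coordinate_map f -> coordinate_map g -> coordinate_map (fun x => g (f x)).
Proof. by move=> [s hs] [r hr]; exists (s \o r) => x; rewrite hr hs. Qed.

Lemma coord_fst : coordinate_map (fun p : X * Y => p.1).
Proof. by exists (@lshift _ _) => p; rewrite [in RHS]/emb /= tcat_lshift. Qed.

Lemma coord_snd : coordinate_map (fun p : X * Y => p.2).
Proof. by exists (@rshift _ _) => p; rewrite [in RHS]/emb /= tcat_rshift. Qed.

Lemma coord_pair (f : X -> Y) (g : X -> Z) :
  coordinate_map f -> coordinate_map g -> coordinate_map (fun x => (f x, g x)).
Proof.
move=> [s hs] [r hr]; exists (tcat s r) => x.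
by rewrite comp_tcat -hs -hr.
Qed.

Lemma dset_coord (f : X -> Y) (P : set Y) :
  coordinate_map f -> dset P -> dset [set x | P (f x)].
Proof.
move=> [s hs] /definableP/(interpreted_reindex s)/definableP dP.
by apply: (dset_trace dP) => x; rewrite /mkset -hs mem_emb.
Qed.

Lemma dset_coord_eq (f g : X -> Y) :
  coordinate_map f -> coordinate_map g -> dset [set x | f x = g x].
Proof.
move=> [s hs] [r hr].
have /definableP dE := interpreted_eq (M := N) id C s r.
apply: (dset_trace dE) => x; rewrite /mkset -hs -hr.
by split=> [->//|e]; exact: emb_inj e.
Qed.

Lemma dset_ex (P : set (X * Y)) : dset P -> dset [set x | exists y, P (x, y)].
Proof.
move=> /definableP/interpreted_ex/definableP dP; apply: (dset_trace dP) => x.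
split=> [[y Pxy]|[v [[x' y] Pxy /tcat_inj[ex _]]]]; last first.
  by exists y; rewrite -(emb_inj ex).
by exists (emb y), (x, y).
Qed.

End Maps.
End Sorts.

Arguments emb_inj {L N C X _} [x1 x2].
Arguments emb_def {L N C X _}.
Arguments dset_setT {L N C X sX}.
Arguments coord_id {L N C X sX}.
Arguments coord_fst {L N C X Y sX sY}.
Arguments coord_snd {L N C X Y sX sY}.

Section DefinableMaps.
Context (L : language) (N : structure L) (C : set N).
Local Notation sort := (dsort C).

Lemma dmap_coord (X Y : Type) {sX : sort X} {sY : sort Y} (f : X -> Y) :
  coordinate_map f -> dmap f.
Proof.
move=> cf.
by have := dset_coord_eq (coord_comp (coord_fst (Y := Y)) cf) coord_snd.
Qed.

Context (X Y Z : Type) {sX : sort X} {sY : sort Y} {sZ : sort Z}.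

Lemma dset_preim (f : X -> Y) (P : set Y) :
  dmap f -> dset P -> dset [set x | P (f x)].
Proof.
move=> df dP.
have := dset_ex (dset_setI df (dset_coord coord_snd dP)).
by apply: dset_iff => x; split=> [[y [/= -> ]]|Pf] //; exists (f x).
Qed.

Lemma dmap_comp (f : X -> Y) (g : Y -> Z) : dmap f -> dmap g -> dmap (g \o f).
Proof.
move=> df dg.
have c1 : coordinate_map (fun p : X * Z * Y => (p.1.1, p.2)).
  by apply: coord_pair coord_snd; exact: coord_comp coord_fst coord_fst.
have c2 : coordinate_map (fun p : X * Z * Y => (p.2, p.1.2)).
  by apply: coord_pair coord_snd _; exact: coord_comp coord_fst coord_snd.
have := dset_ex (dset_setI (dset_coord c1 df) (dset_coord c2 dg)).
apply: dset_iff => -[x z]; split=> [[y [/= -> ]]|/= fz] //.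
by exists (f x).
Qed.

Lemma dmap_pair (f : X -> Y) (g : X -> Z) :
  dmap f -> dmap g -> dmap (fun x => (f x, g x)).
Proof.
move=> df dg.
have c1 : coordinate_map (fun p : X * (Y * Z) => (p.1, p.2.1)).
  by apply: coord_pair coord_fst _; exact: coord_comp coord_snd coord_fst.
have c2 : coordinate_map (fun p : X * (Y * Z) => (p.1, p.2.2)).
  by apply: coord_pair coord_fst _; exact: coord_comp coord_snd coord_snd.
have := dset_setI (dset_coord c1 df) (dset_coord c2 dg).
by apply: dset_iff => -[x [y z]] /=; split=> [[/= -> ->]|[-> ->]].
Qed.

Lemma dmap_const (c : Y) : dset [set c] -> dmap (fun _ : X => c).
Proof.
move=> /(dset_coord (f := fun p : X * Y => p.2) coord_snd).
by apply: dset_iff => p; split.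
Qed.

Lemma dmap_id : dmap (fun x : X => x).
Proof. exact: dmap_coord coord_id. Qed.

Lemma dmap_fst : dmap (fun p : X * Y => p.1).
Proof. exact: dmap_coord coord_fst. Qed.

Lemma dmap_snd : dmap (fun p : X * Y => p.2).
Proof. exact: dmap_coord coord_snd. Qed.

End DefinableMaps.

Arguments dmap_id {L N C X sX}.
Arguments dmap_fst {L N C X Y sX sY}.
Arguments dmap_snd {L N C X Y sX sY}.

Section TypeDefinable.
Context (L : language) (N : structure L) (C : set N).
Local Notation sort := (dsort C).

(** Type-definability, expressed by the family of all definable supersets rather
    than by a chosen one; this family is closed under intersection, as compactness
    arguments require. *)
Definition tset (X : Type) {sX : sort X} (P : set X) : Prop :=
  forall x, (forall Y, dset Y -> P `<=` Y -> Y x) -> P x.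

Context (X Y : Type) {sX : sort X} {sY : sort Y}.
Implicit Types P Q : set X.

Lemma tset_bigcap I (D : set I) (F : I -> set X) :
  (forall i, D i -> tset (F i)) -> tset (\bigcap_(i in D) F i).
Proof.
move=> tF x h i Di; apply: tF => // Z dZ FZ; apply: h => // y; move/(_ i Di).
exact: FZ.
Qed.

Lemma tset_preim (f : X -> Y) (P : set Y) :
  dmap f -> tset P -> tset [set x | P (f x)].
Proof.
move=> df tP x h; apply: tP => Z dZ PZ.
by apply: (h [set x | Z (f x)]); [exact: dset_preim|move=> y; exact: PZ].
Qed.

Lemma tset_type_definable P : tset P <-> type_definable C (emb @` P).
Proof.
split=> [tP|[F Fd PF] x h].
  exists [set emb @` Z | Z in [set Z : set X | dset Z /\ P `<=` Z]].
    by move=> _ [Z [dZ _] <-].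
  apply/seteqP; split=> [_ [x Px <-] _ [Z [_ PZ] <-]|t h].
    by exists x => //; exact: PZ.
  have [x _ ex] : (emb @` [set: X]) t.
    by apply: h; exists [set: X] => //; split=> //; exact: dset_setT.
  exists x => //; apply: tP => Z dZ PZ; rewrite -mem_emb ex; apply: h.
  by exists Z.
rewrite -mem_emb PF => Z FZ.
apply: (h [set x | Z (emb x)]); first exact: dset_trace (Fd _ FZ) _.
move=> y; rewrite -mem_emb PF; exact.
Qed.

End TypeDefinable.

Section Invariance.
Context (L : language) (N : structure L) (C : set N).
Local Notation sort := (dsort C).

(** [x'] is the image of [x] under the map that the automorphism [s] of the
    structure induces on the sort. *)
Definition conjugate (X : Type) {sX : sort X} (s : N -> N) (x x' : X) : Prop :=
  emb x' = s \o emb x.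

Definition invset (X : Type) {sX : sort X} (P : set X) : Prop :=
  forall s x x', aut_fixing C s -> conjugate s x x' -> P x -> P x'.

Section OneSort.
Context (X : Type) {sX : sort X}.
Implicit Types P Q : set X.

Lemma conjugate_exists s (x : X) : aut_fixing C s -> exists x', conjugate s x x'.
Proof.
move=> sC; have [_ /(_ _)[|x' _ ex]] := definable_automorphism (emb x) sC emb_def.
  by exists x.
by exists x'.
Qed.

Lemma conjugate_fun s (x x1 x2 : X) : conjugate s x x1 -> conjugate s x x2 -> x1 = x2.
Proof. by move=> e1 e2; apply: emb_inj; rewrite e1 e2. Qed.

Lemma conjugateV s s' (x x' : X) : cancel s s' -> conjugate s x x' -> conjugate s' x' x.
Proof. by move=> sK ex; rewrite /conjugate ex; apply/funext => i /=; rewrite sK. Qed.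

Lemma dset_invset P : dset P -> invset P.
Proof.
move=> dP s x x' sC ex; rewrite -!mem_emb ex.
by move/(definable_automorphism (emb x) sC dP).
Qed.

Lemma tset_invset P : tset P -> invset P.
Proof.
move=> tP s x x' sC ex Px; apply: tP => Z dZ PZ.
exact: dset_invset dZ _ _ _ sC ex (PZ _ Px).
Qed.

Lemma invsetP P : invset P <-> Defs.invariant C (emb @` P).
Proof.
split=> [iP s sC|iP s x x' sC ex Px]; last first.
  by rewrite -mem_emb -(iP s sC) ex; exists (emb x) => //; exists x.
have [s' [s'C sK s'K]] := aut_fixing_inv sC.
apply/seteqP; split=> [_ [_ [x Px <-] <-]|_ [x Px <-]].
  have [x' ex] := conjugate_exists x sC.
  by exists x' => //; exact: iP sC ex Px.
have [x' ex] := conjugate_exists x s'C.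
exists (emb x'); first by exists x' => //; exact: iP s'C ex Px.
by rewrite -(conjugateV s'K ex).
Qed.

End OneSort.

Lemma conjugate_dmap (X Y : Type) {sX : sort X} {sY : sort Y} (f : X -> Y) s x x' :
  dmap f -> aut_fixing C s -> conjugate s x x' -> conjugate s (f x) (f x').
Proof.
move=> df sC ex; have [y' ey] := conjugate_exists (f x) sC.
suff -> : f x' = y' by [].
have := @dset_invset _ _ _ df s (x, f x) (x', y') sC _ erefl; apply.
by rewrite /conjugate comp_tcat -ex -ey.
Qed.

Lemma conjugate_pair (X Y : Type) {sX : sort X} {sY : sort Y} s (x x' : X * Y) :
  conjugate s x x' <-> conjugate s x.1 x'.1 /\ conjugate s x.2 x'.2.
Proof.
rewrite /conjugate; split=> [e|[e1 e2]].
  have /tcat_inj[-> ->] // :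
      tcat (emb x'.1) (emb x'.2) = tcat (s \o emb x.1) (s \o emb x.2).
  by rewrite -comp_tcat; exact: e.
by rewrite [in RHS]/emb /= comp_tcat -e1 -e2.
Qed.

End Invariance.

(** * Compactness *)

Section Compactness.
Context (K : Type) (L : language) (N : structure L) (C : set N).
Hypothesis N_monster : monster K N.
Hypothesis C_finite : finite_set C.
Local Notation sort := (dsort C).

Lemma small_symbols : small K [set: set (symbols L)].
Proof. by have [] := N_monster. Qed.

(** Saturation for the members of a sort. The sets in [F] may use parameters from
    [w]; the points of [w] have finitely many coordinates each, which together with
    the finite set [C] are counted by [option I * nat]. *)
Lemma compactness (X Z : Type) {sX : sort X} {sZ : sort Z} (I : Type) (w : I -> Z)
    (F : set (set X)) :
  small K [set: option I * nat] ->
  (forall Y, F Y -> exists i (Q : set (X * Z)),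
     dset Q /\ forall x, Y x <-> Q (x, w i)) ->
  (forall q : seq (set X), (forall Y, Y \in q -> F Y) ->
     exists x, forall Y, Y \in q -> Y x) ->
  exists x, forall Y, F Y -> Y x.
Proof.
move=> sI Fdef Ffip.
have [_ sat _] := N_monster.
pose D : set N := C `|` [set a | exists i c, a = @emb _ _ _ _ sZ (w i) c].
pose p : set (set (tup N (@sdim _ _ _ _ sX))) := 
  [set S | S = range (@emb _ _ _ _ sX) \/ exists2 Y, F Y & S = emb @` Y].
have /countable_injP[g g_inj] := finite_set_countable C_finite.
have sD : small K D.
  apply: (small_rel (r := fun a (u : option I * nat) => match u.1 with
     | None => C a /\ u.2 = g a
     | Some i => exists2 c : 'I_(@sdim _ _ _ _ sZ), a = emb (w i) c & u.2 = c end)) sI.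
    move=> a [Ca|[i [c ->]]]; first by exists (None, g a).
    by exists (Some i, val c) => //; exists c.
  move=> a a' [[i|] n] _ _ /=.
    by move=> [c -> ->] [c' -> /val_inj ->].
  by move=> [Ca ->] [Ca' e]; apply: g_inj e; rewrite inE.
have pD : p `<=` definable D (n := _).
  move=> _ [->|[Y /Fdef[i [Q [dQ YQ]]] ->]].
    by apply: definable_sub emb_def; left.
  have CD : C `<=` D by left.
  have /definableP dE := definable_sub CD (@emb_def _ _ _ _ sX).
  have /definableP dQ' := definable_sub CD dQ.
  have Di c : D (@emb _ _ _ _ sZ (w i) c) by right; exists i, c.
  have /definableP := interpreted_setI dE (interpreted_param Di dQ').
  congr definable; apply/seteqP; split=> [t [[x _ <-] [[x' z] Qx /tcat_inj[ex ez]]]|].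
    by exists x => //; apply/YQ; rewrite -(emb_inj ex) -(emb_inj ez).
  move=> _ [x /YQ Qx <-]; split; first by exists x.
  by exists (x, w i).
have [q qp q_fin|t ht] := sat D _ p sD pD.
  have [s0 qs] := (finite_seqP q).1 q_fin.
  pose s := [seq [set x : X | S0 (@emb _ _ _ _ sX x)] | S0 <- s0 &
    `[< exists2 Y, F Y & S0 = @emb _ _ _ _ sX @` Y >]].
  have sE Y : (Y \in s) -> F Y.
    move=> /mapP[S0]; rewrite mem_filter => /andP[/asboolP[Y' FY' ->] _] ->.
    have -> // : [set x | (emb @` Y') (emb x)] = Y'.
    by rewrite eqEsubset; split=> x; rewrite /mkset mem_emb.
  have [x hx] := Ffip s sE.
  exists (emb x) => S qS; have [->|[Y FY SY]] := qp S qS; first by exists x.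
  apply: (hx [set x | S (emb x)]); apply/mapP; exists S => //.
  rewrite mem_filter; apply/andP; split; first by apply/asboolP; exists Y.
  by move: qS; rewrite qs.
have [x _ ex] : range emb t by apply: ht; left.
by exists x => Y FY; rewrite -mem_emb ex; apply: ht; right; exists Y.
Qed.

Lemma directed_compactness (X Z : Type) {sX : sort X} {sZ : sort Z} (I : Type)
    (w : I -> Z) (F : set (set X)) :
  small K [set: option I * nat] ->
  (forall Y, F Y -> exists i (Q : set (X * Z)),
     dset Q /\ forall x, Y x <-> Q (x, w i)) ->
  F !=set0 ->
  (forall Y Y', F Y -> F Y' -> exists2 Y'', F Y'' & Y'' `<=` Y `&` Y') ->
  (forall Y, F Y -> Y !=set0) ->
  exists x, forall Y, F Y -> Y x.
Proof.
move=> sI Fdef F0 Fdir Fne; apply: compactness sI Fdef _ => q qF.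
suff [Y FY Yq] : exists2 Y, F Y & forall Y', Y' \in q -> Y `<=` Y'.
  have [x Yx] := Fne _ FY.
  by exists x => Y' /Yq; apply.
elim: q qF => [|Y q IH] qF; first by have [Y FY] := F0; exists Y.
have [|Y1 FY1 Y1q] := IH; first by move=> Y' Yq; apply: qF; rewrite inE Yq orbT.
have [|Y2 FY2 Y2Y] := Fdir Y Y1 _ FY1; first by apply: qF; rewrite inE eqxx.
exists Y2 => // Y'; rewrite inE => /predU1P[->|/Y1q Y1Y'] x /Y2Y[] //.
by move=> _; exact: Y1Y'.
Qed.

Lemma small_option_nat (I : Type) (f : I -> nat) :
  injective f -> small K [set: option I * nat].
Proof.
move=> f_inj; apply: (small_countable small_symbols
  (f := fun u : option I * nat => pickle (omap f u.1, u.2))).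
move=> [o n] [o' n'] /(pcan_inj pickleK)[+ ->].
by case: o o' => [i|] [i'|] //= [/f_inj ->].
Qed.

Lemma dset_compactness (X : Type) {sX : sort X} (F : set (set X)) :
  (forall Y, F Y -> dset Y) -> F !=set0 ->
  (forall Y Y', F Y -> F Y' -> exists2 Y'', F Y'' & Y'' `<=` Y `&` Y') ->
  (forall Y, F Y -> Y !=set0) ->
  exists x, forall Y, F Y -> Y x.
Proof.
move=> Fd F0 Fdir Fne; have [Y0 FY0] := F0; have [x0 _] := Fne _ FY0.
apply: (@directed_compactness _ _ _ _ unit (fun=> x0)) F0 Fdir Fne.
  by apply: (@small_option_nat _ (fun=> 0%N)); do 2![case].
move=> Y /Fd dY; exists tt, [set p | Y p.1]; split=> //.
exact: dset_coord coord_fst dY.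
Qed.

(** If [x] lies in all definable sets containing the projection of [P], then the
    sections over [x] of the definable sets containing [P] are nonempty, and by
    compactness they have a common point. *)
Lemma tset_ex (X Y : Type) {sX : sort X} {sY : sort Y} (P : set (X * Y)) :
  tset P -> tset [set x | exists y, P (x, y)].
Proof.
move=> tP x hx.
pose F : set (set Y) := [set S | exists2 W : set (X * Y),
   @dset _ _ _ _ (prod_sort sX sY) W /\ P `<=` W &
   S = [set y | W (x, y)]].
have [|||||y Fy] := @directed_compactness _ _ _ _ unit (fun=> x) F.
- by apply: (@small_option_nat _ (fun=> 0%N)); do 2![case].
- move=> _ [W [dW PW] ->]; exists tt, [set p | W (p.2, p.1)]; split=> //.
  exact: dset_coord (coord_pair coord_snd coord_fst) dW.
- by exists [set: Y]; exists [set: X * Y] => //; split=> //; exact: dset_setT.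
- move=> _ _ [W [dW PW] ->] [W' [dW' PW'] ->].
  exists [set y | (W `&` W') (x, y)] => //; exists (W `&` W') => //.
  by split; [exact: dset_setI|move=> p Pp; split; [exact: PW|exact: PW']].
- move=> _ [W [dW PW] ->].
  have [y Wxy] : [set x | exists y, W (x, y)] x.
    by apply: hx; [exact: dset_ex|move=> x' [y /PW Wy]; exists y].
  by exists y.
exists y; apply: tP => W dW PW.
by apply: (Fy [set y | W (x, y)]); exists W.
Qed.

End Compactness.

(** * Bounded type-definable equivalence relations *)

Section BoundedEquivalence.
Context (K : Type) (L : language) (N : structure L) (C : set N).
Hypothesis N_monster : monster K N.
Hypothesis C_finite : finite_set C.
Context (X : Type) {sX : dsort C X}.
Implicit Types R Y : set (X * X).

Definition equivalence_set R : Prop :=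
  [/\ forall x, R (x, x), forall x y, R (x, y) -> R (y, x)
    & forall x y z, R (x, y) -> R (y, z) -> R (x, z)].

(** Transitivity, made approximate by compactness: otherwise the triples violating
    it for each definable superset of [R] would have a common point, which would
    violate it for [R]. *)
Lemma equivalence_halving R Y : equivalence_set R -> tset R -> dset Y -> R `<=` Y ->
  exists Y', [/\ dset Y', R `<=` Y' &
    forall x y z, Y' (x, y) -> Y' (x, z) -> Y (y, z)].
Proof.
move=> [_ Rsym Rtrans] tR dY RY; apply: contrapT => noY'.
pose bad Y' : set (X * X * X) :=
  [set u | [/\ Y' u.1, Y' (u.1.1, u.2) & ~ Y (u.1.2, u.2)]].
pose F : set (set (X * X * X)) :=
  [set S | exists2 Y', @dset _ _ _ _ (prod_sort sX sX) Y' /\ R `<=` Y' & S = bad Y'].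
have [||||u Fu] := dset_compactness N_monster C_finite (F := F).
- move=> _ [Y' [dY' RY'] ->].
  have c1 : coordinate_map (fun u : X * X * X => (u.1.1, u.2)).
    by apply: coord_pair coord_snd; exact: coord_comp coord_fst coord_fst.
  have c2 : coordinate_map (fun u : X * X * X => (u.1.2, u.2)).
    by apply: coord_pair coord_snd; exact: coord_comp coord_fst coord_snd.
  have := dset_setI (dset_setI (dset_coord coord_fst dY') (dset_coord c1 dY'))
    (dset_coord c2 (dset_setC dY)).
  by apply: dset_iff => v; split=> [[[]]|[]].
- by exists (bad [set: X * X]); exists [set: X * X] => //; split=> //; exact: dset_setT.
- move=> _ _ [Y1 [dY1 RY1] ->] [Y2 [dY2 RY2] ->].
  exists (bad (Y1 `&` Y2)); last by move=> v [[? ?] [? ?] ?]; split.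
  exists (Y1 `&` Y2) => //; split; first exact: dset_setI.
  by move=> v Rv; split; [exact: RY1|exact: RY2].
- move=> _ [Y' [dY' RY'] ->]; apply: contrapT => bad0; apply: noY'.
  exists Y'; split=> // x y z xy xz; apply: contrapT => nyz.
  by apply: bad0; exists (x, y, z).
have badu Y' : dset Y' -> R `<=` Y' -> bad Y' u.
  by move=> dY' RY'; apply: Fu; exists Y'.
case: u {Fu} badu => -[x y] z badu.
have [_ _] := badu _ (@dset_setT _ _ _ _ (prod_sort sX sX)) (fun _ _ => I).
apply; apply: RY; apply: (Rtrans _ x).
  by apply: Rsym; apply: tR => Y' dY' RY'; have [] := badu _ dY' RY'.
by apply: tR => Y' dY' RY'; have [] := badu _ dY' RY'.
Qed.

(** A maximal set [A] of pairwise [Y]-unrelated points meets each class of [R] at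
    most once, so it is small, and saturation applies to parameters from [A]. By
    maximality no point avoids all the sections of [Y] over [A]; hence none avoids
    some finite number of them. *)
Lemma bounded_finite_cover R Y : equivalence_set R ->
  small K (range (fun x => [set y | R (x, y)])) -> dset Y -> R `<=` Y ->
  exists2 W : set X, finite_set W & forall z, exists2 x, W x & Y (x, z).
Proof.
move=> [Rxx Rsym Rtrans] Rsmall dY RY.
pose free (A : set X) := forall x y, A x -> A y -> x <> y -> ~ (Y (x, y) /\ Y (y, x)).
have [|A [Afree Amax]] := @Zorn_bigcup _ free.
  move=> F Ff Ftot x y [S FS Sx] [S' FS' Sy] xy.
  have [SS'|S'S] := Ftot _ _ FS FS'.
    exact: Ff FS' _ _ (SS' _ Sx) Sy xy.
  exact: Ff FS _ _ Sx (S'S _ Sy) xy.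
have Acover z : exists2 x, A x & Y (x, z).
  apply: contrapT => nz.
  have Az : ~ A z by move=> Az; apply: nz; exists z => //; exact: RY.
  apply: (Amax (A `|` [set z])).
    by split=> [x|sub]; [left|apply: Az; apply: sub; right].
  have zfree x : A x -> ~ Y (x, z) by move=> Ax Yxz; apply: nz; exists x.
  move=> x y [Ax|->] [Ay|->] xy // [Yxy Yyx].
    exact: Afree Ax Ay xy (conj Yxy Yyx).
    exact: zfree Ax Yxy.
  exact: zfree Ay Yyx.
have [Afin|/infiniteP/card_leTP[f f_inj fA]] := pselect (finite_set A).
  by exists A.
pose U := {x : X | A x}.
have [p p_inj] : exists p : U -> U -> U,
    forall x y x' y', p x y = p x' y' -> x = x' /\ y = y'.
  apply: (@exists_pairing _ (fun i => exist _ (f i) (fA i))).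
  by move=> i i' [/f_inj].
pose e i : U := exist _ (f i) (fA i).
have e_inj i i' : e i = e i' -> i = i' by move=> [/f_inj].
have small_U : small K [set: U].
  apply: (small_fun (f := fun x : U => [set y | R (sval x, y)])) Rsmall.
    by move=> x _; exists (sval x).
  move=> [x Ax] [x' Ax'] _ _ /= Rxx'; apply: eq_exist => /=; apply: contrapT => xx'.
  have Rx : R (x, x') by rewrite -[R _]/([set y | R (x, y)] x') Rxx'; exact: Rxx.
  by apply: (Afree _ _ Ax Ax' xx'); split; apply: RY => //; exact: Rsym.
(* [A] is infinite here, so that a pairing makes its product with [nat] no larger. *)
have small_oU : small K [set: option U * nat].
  apply: (small_fun (f := fun u : option U * nat => match u.1 with
    | Some x => p (p x (e 0)) (e u.2) | None => p (p (e 0) (e 1)) (e u.2) end))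
    small_U => //.
  move=> [[x|] i] [[x'|] i'] _ _ /= /p_inj[/p_inj[+ +] /e_inj ->].
  - by move=> ->.
  - by move=> _ /e_inj.
  - by move=> _ /e_inj.
  - by [].
pose F : set (set X) := [set S | exists2 x, A x & S = [set z | ~ Y (x, z)]].
have [q qF qcover] : exists2 q : seq (set X), (forall S, S \in q -> F S) &
    forall z, exists2 S : set X, S \in q & ~ S z.
  apply: contrapT => noq.
  have [|q qF|z Fz] := compactness N_monster C_finite (w := @sval X A) (F := F)
    small_oU.
  - move=> _ [x Ax ->]; exists (exist _ x Ax), [set v | ~ Y (v.2, v.1)]; split=> //.
    exact: dset_coord (coord_pair coord_snd coord_fst) (dset_setC dY).
  - apply: contrapT => nx; apply: noq; exists q => // z; apply: contrapT => nz.
    apply: nx; exists z => S qS; apply: contrapT => nS; apply: nz; by exists S.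
  - have [x Ax Yxz] := Acover z.
    by apply: (Fz [set z | ~ Y (x, z)]) => //; exists x.
have /choice[g gP] : forall S : set X, exists x,
    F S -> A x /\ S = [set z | ~ Y (x, z)].
  move=> S; have [[x Ax SE]|nF] := pselect (F S); first by exists x.
  by exists (f 0) => /nF.
exists (g @` [set` q]).
  by apply: finite_image; apply/finite_seqP; exists q.
move=> z; have [S qS nSz] := qcover z; have [_ SE] := gP _ (qF _ qS).
exists (g S); first by exists S.
by apply: contrapT => nY; apply: nSz; rewrite SE.
Qed.

(** The code of a point tells, for each definable superset [Y] of some relation of
    the family and each section of a fixed finite cover by sections of [Y], whether
    the point lies in that section. Two points with the same code share a section
    of each [Y], hence are related by each relation, by approximate transitivity. *)
Lemma bounded_equivalence_code (E : set (set (X * X))) :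
  (forall R, E R -> [/\ equivalence_set R, tset R &
     small K (range (fun x => [set y | R (x, y)]))]) ->
  exists phi : X -> set (symbols L), forall x y, phi x = phi y ->
    forall R, E R -> R (x, y).
Proof.
move=> EP.
have [p p_inj] : exists p : symbols L -> symbols L -> symbols L,
    forall x y x' y', p x y = p x' y' -> x = x' /\ y = y'.
  by apply: (@exists_pairing _ (symbol_nat L)) => i i' [].
have [c c_inj] := exists_definable_code p_inj (@sdim _ _ _ _ (prod_sort sX sX))
  (finite_set_countable C_finite).
pose good (Y : set (X * X)) :=
  @dset _ _ _ _ (prod_sort sX sX) Y /\ exists2 R, E R & R `<=` Y.
have /choice[W WP] : forall Y : set (X * X), exists W : set X,
    good Y -> finite_set W /\ forall z, exists2 x, W x & Y (x, z).
  move=> Y; have [[dY [R ER RY]]|nY] := pselect (good Y); last by exists set0 => /nY.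
  have [eR _ bR] := EP _ ER.
  by have [W Wf Wc] := bounded_finite_cover eR bR dY RY; exists W.
have /choice[g gP] : forall Y : set (X * X), exists g : X -> nat,
    good Y -> forall x y, W Y x -> W Y y -> g x = g y -> x = y.
  move=> Y; have [gY|nY] := pselect (good Y); last by exists (fun=> 0) => /nY.
  have [/finite_set_countable/countable_injP[g g_inj] _] := WP _ gY.
  by exists g => _ x y Wx Wy; apply: g_inj; rewrite inE.
pose cY (Y : set (X * X)) := c (@emb _ _ _ _ (prod_sort sX sX) @` Y).
have cY_inj Y Y' : good Y -> good Y' -> cY Y = cY Y' -> Y = Y'.
  move=> [dY _] [dY' _] /c_inj-/(_ dY dY') YY'.
  by apply/seteqP; split=> u; rewrite -!mem_emb YY'.
pose phi x : set (symbols L) := [set t | exists Y w,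
  [/\ good Y, W Y w, Y (w, x) & t = p (cY Y) (symbol_nat L (g Y w))]].
exists phi => x y phixy R ER; have [eR tR bR] := EP _ ER.
apply: (tR (x, y)) => Y dY RY.
have [Y' [dY' RY' halve]] := equivalence_halving eR tR dY RY.
have gY' : good Y' by split=> //; exists R.
have [_ /(_ x)[w Ww Ywx]] := WP _ gY'.
have : phi x (p (cY Y') (symbol_nat L (g Y' w))) by exists Y', w.
rewrite phixy => -[Y'' [w' [gY'' Ww' Yw'y]]].
move=> /p_inj[/(cY_inj _ _ gY' gY'') YY'' [gw]].
subst Y''; have ww' := gP _ gY' _ _ Ww Ww' gw; subst w'.
exact: halve Ywx Yw'y.
Qed.

End BoundedEquivalence.

(** * Components of definable groups *)

Section BoundedIndex.
Context (K : Type) (L : language) (N : structure L) (C : set N).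
Hypothesis N_monster : monster K N.
Hypothesis C_finite : finite_set C.

Section Groups.
Local Open Scope group_scope.
Context (X : groupType) {sX : dsort C X}.
Hypothesis dmap_ldiv : dmap (fun p : X * X => p.1^-1 * p.2).

(** Bounded index in a form stable under intersections and extensions: the cosets
    are separated by at most as many codes as there are sets of symbols. *)
Definition coded_index (S : set X) : Prop :=
  exists phi : X -> set (symbols L),
    forall x y, phi x = phi y -> S (x^-1 * y).

Lemma lcosetE (S : set X) x : [set x * y | y in S] = [set y | S (x^-1 * y)].
Proof.
apply/seteqP; split=> [_ [y Sy <-]|y Sy] /=; first by rewrite mulKg.
by exists (x^-1 * y) => //; rewrite mulVKg.
Qed.

Lemma subgroup_equivalence (S : set X) :
  subgroup S -> equivalence_set [set p : X * X | S (p.1^-1 * p.2)].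
Proof.
move=> [S1 SM SV]; split=> [x|x y|x y z] /=; first by rewrite mulVg.
  by move=> /SV; rewrite invgM invgK.
by move=> Sxy /(SM _ _ Sxy); rewrite -mulgA mulVKg.
Qed.

Lemma coded_bounded_index (S : set X) :
  subgroup S -> coded_index S -> bounded_index K S.
Proof.
move=> /subgroup_equivalence[_ Ssym Strans] [phi phiP].
apply: (small_range (phi := phi) _ (small_symbols N_monster)) => x y /phiP Sxy.
rewrite !lcosetE; apply/seteqP; split=> z /= Sz.
  exact: (Strans y x z (Ssym x y Sxy) Sz).
exact: (Strans x y z Sxy Sz).
Qed.

Lemma bounded_index_code (E : set (set X)) :
  (forall S, E S -> [/\ subgroup S, bounded_index K S & tset S]) ->
  coded_index (\bigcap_(S in E) S).
Proof.
move=> EP.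
have [|phi phiP] := bounded_equivalence_code N_monster C_finite
  (E := [set [set p : X * X | S (p.1^-1 * p.2)] | S in E]).
  move=> _ [S /EP[Ssub Sb St] <-]; split.
  - exact: subgroup_equivalence.
  - exact: tset_preim dmap_ldiv St.
  - by move: Sb; rewrite /bounded_index; under eq_fun do rewrite lcosetE.
exists phi => x y /phiP h S ES.
by apply: (h [set p : X * X | S (p.1^-1 * p.2)]); exists S.
Qed.

Lemma subgroup_bigcap (E : set (set X)) :
  (forall S, E S -> subgroup S) -> subgroup (\bigcap_(S in E) S).
Proof.
move=> EP; split.
- by move=> S /EP[].
- move=> x y Ex Ey S ES; have [_ SM _] := EP _ ES.
  by apply: SM; [exact: Ex|exact: Ey].
- by move=> x Ex S ES; have [_ _ SV] := EP _ ES; apply: SV; exact: Ex.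
Qed.

(** One code for all type-definable subgroups of bounded index separates the cosets
    of their intersection. *)
Lemma comp00P : let Q := comp00 K C (@emb _ _ _ X _) in
  [/\ subgroup Q, coded_index Q & tset Q].
Proof.
rewrite /comp00 /smallest; set E := [set S | _].
have EP S : E S -> [/\ subgroup S, bounded_index K S & tset S].
  by move=> [[Ssub Sb St] _]; split=> //; exact/tset_type_definable.
split; first by apply: subgroup_bigcap => S /EP[].
  exact: bounded_index_code.
by apply: tset_bigcap => S /EP[].
Qed.

Lemma comp00_sub (S : set X) :
  subgroup S -> coded_index S -> tset S -> comp00 K C (@emb _ _ _ X _) `<=` S.
Proof.
move=> Ssub Sc St; apply: smallest_sub => //; split=> //.
  exact: coded_bounded_index.
exact/tset_type_definable.
Qed.

Lemma comp000_sub (S : set X) :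
  subgroup S -> coded_index S -> invset S -> comp000 K C (@emb _ _ _ X _) `<=` S.
Proof.
move=> Ssub Sc Si; apply: smallest_sub => //; split=> //.
  exact: coded_bounded_index.
exact/invsetP.
Qed.

Lemma comp000_comp00 : comp000 K C (@emb _ _ _ X _) `<=` comp00 K C (@emb _ _ _ X _).
Proof.
by have [Qsub Qc Qt] := comp00P; apply: comp000_sub => //; exact: tset_invset.
Qed.

End Groups.

Section AdditiveGroups.
Local Open Scope ring_scope.
Import GRing.Theory.
Context (A : zmodType) {sA : dsort C A}.
Hypothesis dmap_sub : dmap (fun p : A * A => p.2 - p.1).
Context (A1 : set A).
Hypotheses (A1_sub : add_subgroup A1) (A1_bounded : add_bounded_index K A1)
  (A1_tset : tset A1).

Lemma add_cosetE (S : set A) x : [set x + y | y in S] = [set y | S (y - x)].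
Proof.
apply/seteqP; split=> [_ [y Sy <-]|y Sy] /=; first by rewrite addrC addKr.
by exists (y - x) => //; rewrite addrC subrK.
Qed.

Lemma add_equivalence : equivalence_set [set p : A * A | A1 (p.2 - p.1)].
Proof.
have [S0 SD SN] := A1_sub; split=> [x|x y|x y z] /=; first by rewrite subrr.
  by move=> /SN; rewrite opprB.
by move=> Sxy Syz; rewrite -(subrK y z) -addrA; exact: SD.
Qed.

Lemma add_small : small K (range (fun x => [set y | A1 (y - x)])).
Proof.
by move: A1_bounded; rewrite /add_bounded_index; under eq_fun do rewrite add_cosetE.
Qed.

Lemma add_bounded_index_code : exists phi : A -> set (symbols L),
  forall x y, phi x = phi y -> A1 (y - x).
Proof.
have [|phi phiP] := bounded_equivalence_code N_monster C_finite
  (E := [set [set p : A * A | A1 (p.2 - p.1)]]).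
  move=> _ ->; split; [exact: add_equivalence|exact: tset_preim dmap_sub A1_tset|].
  exact: add_small.
by exists phi => x y /phiP/(_ _ erefl).
Qed.

End AdditiveGroups.
End BoundedIndex.

(** * Countable closed subgroups *)

Section CountableCosets.
Import GRing.Theory.
Local Open Scope ring_scope.
Context (K : Type) (L : language) (N : structure L) (C : set N).
Hypothesis N_monster : monster K N.
Hypothesis C_finite : finite_set C.
Context (A : zmodType) {sA : dsort C A}.
Hypothesis dmap_sub : dmap (fun p : A * A => p.2 - p.1).
Context (A1 : set A).
Hypotheses (A1_sub : add_subgroup A1) (A1_bounded : add_bounded_index K A1)
  (A1_tset : tset A1).

Let nbhd (Z : set A) : Prop := dset Z /\ A1 `<=` Z.

Let nbhdI Z Z' : nbhd Z -> nbhd Z' -> nbhd (Z `&` Z').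
Proof.
move=> [dZ AZ] [dZ' AZ']; split; first exact: dset_setI.
by move=> x Ax; split; [exact: AZ|exact: AZ'].
Qed.

Let nbhd_halving Z : nbhd Z ->
  exists2 W, nbhd W & forall x y, W x -> W y -> Z (x - y).
Proof.
move=> [dZ AZ]; apply: contrapT => noW.
pose bad W : set (A * A) := [set p | [/\ W p.1, W p.2 & ~ Z (p.2 - p.1)]].
have [||||u Fu] := dset_compactness N_monster C_finite
  (F := [set S | exists2 W, nbhd W & S = bad W]).
- move=> _ [W [dW AW] ->].
  have := dset_setI (dset_setI (dset_coord coord_fst dW) (dset_coord coord_snd dW))
    (dset_setC (dset_preim dmap_sub dZ)).
  by apply: dset_iff => v; split=> [[[]]|[]].
- by exists (bad setT), setT => //; split=> //; exact: dset_setT.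
- move=> _ _ [W nW ->] [W' nW' ->]; exists (bad (W `&` W')).
    by exists (W `&` W') => //; exact: nbhdI.
  by move=> v [[? ?] [? ?] ?]; split.
- move=> _ [W nW ->]; apply: contrapT => bad0; apply: noW; exists W => //.
  move=> x y Wx Wy; apply: contrapT => nZ; apply: bad0; by exists (y, x).
have badu W : nbhd W -> bad W u by move=> nW; apply: Fu; exists W.
have [_ SD SN] := A1_sub.
have [|_ _] := badu setT; first by split=> //; exact: dset_setT.
apply; apply: AZ; apply: SD; last apply: SN.
  by apply: (A1_tset _) => W dW AW; have [] := badu W.
by apply: (A1_tset _) => W dW AW; have [] := badu W.
Qed.

Context (P : set A) (e : nat -> A).
Hypotheses (P_sub : add_subgroup P) (P_tset : tset P)
  (P_cover : forall a, P a -> exists n, A1 (a - e n))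
  (P_torsion : forall a m, P a -> (0 < m)%N -> A1 (a *+ m) -> A1 a).

(** Infinitely many multiples of [p] meet one of the finitely many translates that
    cover the group; the difference of two of them is near [0], and it is not in
    [A1] by torsion-freeness. *)
Let multiples_nbhd p Z : P p -> ~ A1 p -> nbhd Z -> exists2 q, P q & Z q /\ ~ A1 q.
Proof.
move=> Pp nAp /nbhd_halving[W [dW AW] WZ].
have [||D Df Dcover] := bounded_finite_cover N_monster C_finite (add_equivalence A1_sub)
  (add_small A1_bounded) (Y := [set u | W (u.2 - u.1)]).
- exact: dset_preim dmap_sub dW.
- by move=> u /= /AW.
have /choice[c cP] : forall m : nat, exists x, D x /\ W (p *+ m - x).
  by move=> m; have [x Dx Wx] := Dcover (p *+ m); exists x.
have [m [m' [mm' cmm']]] : exists m m' : nat, (m < m')%N /\ c m = c m'.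
  apply: contrapT => c_inj; move/finite_setPn: Df; apply.
  apply/card_leTP; exists c => [m m' cmm'|m]; last by have [] := cP m.
  by case: (ltngtP m m') => // mm'; case: c_inj; [exists m, m'|exists m', m].
have PX i : P (p *+ i).
  have [P0 PD _] := P_sub.
  by elim: i => [|i IH]; rewrite ?mulr0n // mulrS; exact: PD.
have qE : p *+ (m' - m) = (p *+ m' - c m') - (p *+ m - c m).
  by rewrite cmm' opprB addrA subrK mulrnBr // ltnW.
exists (p *+ (m' - m)); first exact: PX.
split; first by rewrite qE; apply: WZ; [have [] := cP m'|have [] := cP m].
by move=> /P_torsion-/(_ Pp); rewrite subn_gt0 => /(_ mm').
Qed.

(** The points [p] and [p - q] of [P], with [q] near [0] and outside [A1], are in
    different cosets of [A1], so that one of them avoids [e n + A1]. A definable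
    neighbourhood of it still does. *)
Let avoid_coset p0 n (u : A * set A) : P p0 -> ~ A1 p0 -> P u.1 -> nbhd u.2 ->
  exists v : A * set A, [/\ P v.1, nbhd v.2,
    forall z, v.2 z -> u.2 (v.1 + z - u.1) &
    forall z, v.2 z -> ~ A1 (v.1 + z - e n)].
Proof.
case: u => p Z /= Pp0 nAp0 Pp nZ.
have [W nW WZ] := nbhd_halving nZ.
have [A0 AD AN] := A1_sub; have [P0 PD PN] := P_sub.
have [q [Pq Wq nA]] : exists q, [/\ P q, W q & ~ A1 (p - q - e n)].
  have [Ap|nAp] := pselect (A1 (p - e n)); last first.
    by exists 0; split; rewrite ?subr0 //; apply: nW.2.
  have [q Pq [Wq nAq]] := multiples_nbhd Pp0 nAp0 nW.
  exists q; split=> // Aq; apply: nAq.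
  have -> : q = (p - e n) + - (p - q - e n).
    by rewrite [- (p - q - e n)]opprB addrA subrK opprB addrC subrK.
  exact: AD Ap (AN _ Aq).
have [V [dV AV] nV] : exists2 V, nbhd V & ~ V (p - q - e n).
  apply: contrapT => noV; apply: nA; apply: (A1_tset _) => V dV AV.
  by apply: contrapT => nV; apply: noV; exists V.
have [W' nW' W'V] := nbhd_halving (conj dV AV).
exists (p - q, W `&` W'); split=> /=.
- exact: PD Pp (PN _ Pq).
- exact: nbhdI.
- move=> z [Wz _]; have -> : p - q + z - p = z - q.
    by rewrite addrC !addrA addNr add0r addrC.
  exact: WZ.
- move=> z [_ W'z] Az; apply: nV.
  have -> : p - q - e n = (p - q + z - e n) - z.
    by rewrite -!addrA; congr (_ + (_ + _)); rewrite [z + _]addrCA subrr addr0.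
  by apply: W'V => //; exact: nW'.2.
Qed.

(** The Baire category theorem in the compact group [A / A1], carried out with
    definable neighbourhoods. [P / A1] is a closed subgroup; were it nontrivial, its
    points would accumulate at [0], and one could shrink around points of [P] while
    avoiding the cosets [e n + A1] one after the other. By compactness some point of
    [P] would avoid them all. *)
Lemma torsion_free_countable_cosets : P `<=` A1.
Proof.
move=> p0 Pp0; apply: contrapT => nAp0.
have [P0 PD PN] := P_sub; have [A0 AD AN] := A1_sub.
have /choice[f fP] : forall nu : nat * (A * set A), exists v : A * set A,
    P nu.2.1 -> nbhd nu.2.2 -> [/\ P v.1, nbhd v.2,
    forall z, v.2 z -> nu.2.2 (v.1 + z - nu.2.1) &
    forall z, v.2 z -> ~ A1 (v.1 + z - e nu.1)].
  move=> [n u]; have [[Pu nu]|nu] := pselect (P u.1 /\ nbhd u.2).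
    by have [v vP] := avoid_coset n Pp0 nAp0 Pu nu; exists v.
  by exists u => Pu nbu; case: nu.
pose u := fix u n := if n is n'.+1 then f (n', u n') else (0 : A, setT : set A).
have uP n : P (u n).1 /\ nbhd (u n).2.
  elim: n => [|n [Pn nn]]; first by split=> //; split=> //; exact: dset_setT.
  by have [] := fP (n, u n) Pn nn.
pose ball n : set A := [set x | (u n).2 (x - (u n).1)].
have ballS n : ball n.+1 `<=` ball n.
  move=> x bx; have [Pn nn] := uP n; have [_ _ h _] := fP (n, u n) Pn nn.
  by have := h _ bx; rewrite [_ + (_ - _)]addrC subrK.
have ball_le m n : (m <= n)%N -> ball n `<=` ball m.
  by move=> /subnK <-; elim: (n - m)%N => [//|i IH] x /ballS/IH.
pose F : set (set A) := [set S | exists n, exists2 V,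
   @dset _ _ _ _ sA V /\ P `<=` V & S = ball n `&` V].
have [|||||x Fx] := directed_compactness N_monster C_finite
  (w := fun n => (u n).1) (F := F).
- exact: (small_option_nat N_monster (f := id)).
- move=> _ [n [V [dV PV] ->]].
  exists n, [set p | (u n).2 (p.1 - p.2) /\ V p.1]; split=> //.
  have [_ [dn _]] := uP n.
  have := dset_setI
    (dset_coord (coord_pair coord_snd coord_fst) (dset_preim dmap_sub dn))
    (dset_coord coord_fst dV).
  by apply: dset_iff => v; split=> [[]|[]].
- by exists (ball 0 `&` setT); exists 0%N, setT => //; split=> //; exact: dset_setT.
- move=> _ _ [n [V [dV PV] ->]] [n' [V' [dV' PV'] ->]].
  exists (ball (maxn n n') `&` (V `&` V')).
    exists (maxn n n'), (V `&` V') => //; split; first exact: dset_setI.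
    by move=> y Py; split; [exact: PV|exact: PV'].
  move=> y [by_ [Vy V'y]]; split; split=> //.
    exact: ball_le (leq_maxl _ _) _ by_.
  exact: ball_le (leq_maxr _ _) _ by_.
- move=> _ [n [V [dV PV] ->]]; have [Pn [_ An]] := uP n.
  by exists (u n).1; split; [apply: An; rewrite subrr|exact: PV].
have Px : P x.
  apply: (P_tset _) => V dV PV.
  by have [] : (ball 0 `&` V) x; [apply: Fx; exists 0%N, V|].
have [n An] := P_cover Px.
have [bx _] : (ball n.+1 `&` setT) x.
  by apply: Fx; exists n.+1, setT => //; split=> //; exact: dset_setT.
have [Pn nn] := uP n; have [_ _ _ h] := fP (n, u n) Pn nn.
by have := h _ bx; rewrite [_ + (_ - _)]addrC subrK.
Qed.

End CountableCosets.

(** * The extension *)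

(** The graph of a division is that of the operation, with its arguments permuted. *)
Lemma dmap_division (L : language) (N : structure L) (C : set N) (X : Type)
    {sX : dsort C X} (op div : X -> X -> X) :
  (forall x y z, op x z = y <-> div x y = z) ->
  dmap (fun p : X * X => op p.1 p.2) -> dmap (fun p : X * X => div p.1 p.2).
Proof.
move=> opdiv dop.
have c : coordinate_map (fun u : X * X * X => ((u.1.1, u.2), u.1.2)).
  apply: coord_pair (coord_comp coord_fst coord_snd).
  by apply: coord_pair coord_snd; exact: coord_comp coord_fst coord_fst.
by apply: dset_iff (dset_coord c dop) => u; exact: opdiv.
Qed.

Lemma set_pairing (L : language) :
  exists q : set (symbols L) -> set (symbols L) -> set (symbols L),
    forall U V U' V', q U V = q U' V' -> U = U' /\ V = V'.
Proof.
have [|p p_inj] := @exists_pairing _ (symbol_nat L); first by move=> i i' [].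
pose t i U := [set p (symbol_nat L i) x | x in U].
exists (fun U V => t 0 U `|` t 1 V) => U V U' V' e.
have aux U1 V1 U2 V2 : t 0 U1 `|` t 1 V1 = t 0 U2 `|` t 1 V2 ->
    U1 `<=` U2 /\ V1 `<=` V2.
  move=> h; split=> x xU.
    have : (t 0 U1 `|` t 1 V1) (p (symbol_nat L 0) x) by left; exists x.
    by rewrite h => -[[y yU /p_inj[_ <-]]//|[y yV /p_inj[]//]].
  have : (t 0 U1 `|` t 1 V1) (p (symbol_nat L 1) x) by right; exists x.
  by rewrite h => -[[y yU /p_inj[]//]|[y yV /p_inj[_ <-]]].
have [UU' VV'] := aux _ _ _ _ e; have [U'U V'V] := aux _ _ _ _ (esym e).
by split; apply/seteqP.
Qed.

Section ExtensionAlgebra.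
Import GRing.Theory.
Local Open Scope ring_scope.
Context (G : groupType) (A : zmodType) (c : cocycle_action G A).
Local Notation E := (extension c).

Definition ext_incl (a : A) : E := (a, 1%g).

Lemma ext_mulE (x y : E) :
  (x * y)%g = (x.1 + act c x.2 y.1 + coc c x.2 y.2, (x.2 * y.2)%g) :> E.
Proof. by []. Qed.

Lemma ext_inclM a b : (ext_incl a * ext_incl b)%g = ext_incl (a + b).
Proof. by rewrite ext_mulE /= act1 cocg1 addr0 mulg1. Qed.

Lemma ext_inclV a : ((ext_incl a)^-1)%g = ext_incl (- a).
Proof. by apply: (mulgI (ext_incl a)); rewrite mulgV ext_inclM subrr. Qed.

Lemma ext_incl_mul a (x : E) : (ext_incl a * x)%g = (a + x.1, x.2) :> E.
Proof. by rewrite ext_mulE /= act1 coc1g addr0 mul1g. Qed.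

Lemma ext_fiber a b g : (((a, g) : E) * ((b, g) : E)^-1)%g = ext_incl (a - b).
Proof.
by apply: (mulIg ((b, g) : E)); rewrite mulgVK ext_incl_mul /= subrK.
Qed.

Lemma ext_conj a g b :
  (((b, g) : E) * ext_incl a * ((b, g) : E)^-1)%g = ext_incl (act c g a).
Proof.
apply: (mulIg ((b, g) : E)); rewrite mulgVK ext_incl_mul ext_mulE /= cocg1 addr0 mulg1.
by rewrite addrC.
Qed.

Section Thick.
Context (A0 H : set A) (Q : set G).
Hypotheses (A0_sub : add_subgroup A0) (A0_act : act_invariant c A0)
  (A0_coc : forall g k, A0 (coc c g k))
  (H_sub : add_subgroup H) (H_act : act_invariant c H) (Q_sub : subgroup Q).

(** Invariance passes from [H] and [Q] to this subgroup; type-definability does not,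
    as its fibre is a union of possibly infinitely many cosets of [H]. *)
Definition thick : set E :=
  [set x : E | Q x.2 /\ exists2 a0, A0 a0 & H (x.1 + a0)].

Lemma thick_subgroup : subgroup thick.
Proof.
have [A00 A0D A0N] := A0_sub; have [H0 HD HN] := H_sub; have [Q1 QM QV] := Q_sub.
split.
- by split=> //; exists 0 => //; rewrite addr0.
- move=> [a g] [b k] [/= Qg [a0 A0a Ha]] [/= Qk [b0 A0b Hb]].
  split; first exact: QM.
  exists (a0 + act c g b0 - coc c g k).
    by apply: (A0D _ _ _ (A0N _ _)) => //; apply: (A0D _ _) => //; exact: A0_act.
  rewrite /= [_ + _ + coc _ _ _]addrC [X in coc _ _ _ + _ + X]addrC addrACA.
  by rewrite subrr add0r addrACA -actD; apply: (HD _ _) => //; exact: H_act.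
- move=> [a g] [/= Qg [a0 A0a Ha]]; split; first exact: QV.
  exists (- act c g^-1%g a0 + coc c g^-1%g g).
    by apply: (A0D _ _) => //; apply: (A0N _); exact: A0_act.
  rewrite /= addrACA addNr addr0 -opprD -actD; apply: (HN _); exact: H_act.
Qed.

Lemma thick_ldiv (a b : A) (g k : G) : H (b - a) -> Q (g^-1 * k)%g ->
  thick (((a, g) : E)^-1 * ((b, k) : E))%g.
Proof.
have [A00 A0D A0N] := A0_sub.
move=> Hab Qgk; split => //=.
exists (coc c g^-1%g g - coc c g^-1%g k); first by apply: (A0D _ _) => //; exact: A0N.
rewrite addrACA subrr addr0 addrAC subrK addrC -actN -actD; exact: H_act.
Qed.

End Thick.
End ExtensionAlgebra.

(** * The extension as a definable group *)

Section DefinableExtension.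
Import GRing.Theory.
Local Open Scope ring_scope.
Context (L : language) (N : structure L) (C : set N).
Context (G : groupType) (A : zmodType) (c : cocycle_action G A).
Context {sG : dsort C G} {sA : dsort C A}.
Local Notation E := (extension c).

Global Instance extension_sort : dsort C E := prod_sort sA sG.

Hypotheses (dmap_mul : dmap (fun p : G * G => (p.1 * p.2)%g))
  (dmap_add : dmap (fun p : A * A => p.1 + p.2))
  (dmap_act : dmap (fun p : G * A => act c p.1 p.2))
  (dmap_coc : dmap (fun p : G * G => coc c p.1 p.2)).

Lemma dmap_base_ldiv : dmap (fun p : G * G => (p.1^-1 * p.2)%g).
Proof.
apply: (dmap_division (op := fun x y : G => (x * y)%g)
  (div := fun x y => (x^-1 * y)%g) _ dmap_mul).
by move=> x y z; split=> <-; rewrite ?mulKg ?mulVKg.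
Qed.

Lemma dmap_fiber_sub : dmap (fun p : A * A => p.2 - p.1).
Proof.
apply: (dmap_division (op := fun x y : A => x + y) (div := fun x y => y - x) _ dmap_add).
by move=> x y z; split=> <-; [rewrite addrC addKr|rewrite addrC subrK].
Qed.

Lemma dmap_ext_ldiv : dmap (fun p : E * E => (p.1^-1 * p.2)%g).
Proof.
apply: (dmap_division (op := fun x y : E => (x * y)%g)
  (div := fun x y : E => (x^-1 * y)%g)).
  by move=> x y z; split=> <-; rewrite ?mulKg ?mulVKg.
pose sE := extension_sort.
have d1 := dmap_fst (sX := sE) (sY := sE); have d2 := dmap_snd (sX := sE) (sY := sE).
have dA : @dmap _ _ C E A sE sA (fun x => x.1) := dmap_fst (sX := sA) (sY := sG).
have dG : @dmap _ _ C E G sE sG (fun x => x.2) := dmap_snd (sX := sA) (sY := sG).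
have d11 := dmap_comp d1 dA; have d12 := dmap_comp d1 dG.
have d21 := dmap_comp d2 dA; have d22 := dmap_comp d2 dG.
have dact := dmap_comp (dmap_pair d12 d21) dmap_act.
have dcoc := dmap_comp (dmap_pair d12 d22) dmap_coc.
have dmul := dmap_comp (dmap_pair d12 d22) dmap_mul.
have dadd := dmap_comp (dmap_pair d11 dact) dmap_add.
exact: (dmap_pair (dmap_comp (dmap_pair dadd dcoc) dmap_add) dmul).
Qed.

Lemma dset_base1 : dset [set (1%g : G)].
Proof.
have cf : coordinate_map (fun x : G => ((x, x), x)).
  by apply: coord_pair coord_id; exact: coord_pair coord_id coord_id.
apply: dset_iff (dset_coord cf dmap_mul) => x /=.
by split=> [/(congr1 (fun y => x^-1 * y)%g)|->]; rewrite ?mulKg ?mulVg ?mulg1.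
Qed.

Lemma dmap_ext_incl : dmap (@ext_incl G A c).
Proof. exact: dmap_pair dmap_id (dmap_const dset_base1). Qed.

Section Sub.
Context (D : set E).
Hypotheses (D_sub : subgroup D).

Definition fiber : set A := [set a | D (ext_incl c a)].
Definition base : set G := [set g | exists a, D (a, g)].

Lemma fiber_subgroup : add_subgroup fiber.
Proof.
have [D1 DM DV] := D_sub; split; first exact: D1.
  by move=> a b Da Db; rewrite /fiber /mkset -ext_inclM; exact: DM.
by move=> a Da; rewrite /fiber /mkset -ext_inclV; exact: DV.
Qed.

Lemma base_subgroup : subgroup base.
Proof.
have [D1 DM DV] := D_sub; split; first by exists 0.
  move=> g k [a Da] [b Db]; exists (((a, g) : E) * ((b, k) : E))%g.1.
  exact: (DM (a, g) (b, k)).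
by move=> g [a Da]; exists (((a, g) : E)^-1)%g.1; exact: (DV (a, g)).
Qed.


Lemma fiber_tset : tset D -> tset fiber.
Proof. exact: tset_preim dmap_ext_incl. Qed.

Lemma fiber_code : coded_index L D ->
  exists phi : A -> set (symbols L), forall a b, phi a = phi b -> fiber (b - a).
Proof.
move=> [phi phiP]; exists (fun a => phi (ext_incl c a)) => a b /phiP.
by rewrite ext_inclV ext_inclM addrC.
Qed.

Lemma base_code : coded_index L D -> coded_index L base.
Proof.
move=> [phi phiP]; exists (fun g => phi (0, g)) => g k /phiP Dgk.
by eexists; exact: Dgk.
Qed.

(** [D] normalises its fibre, and [A] acts on it trivially by conjugation, so that an
    element [(b, g)] of [D] conjugates the fibre as [g] acts. *)
Lemma fiber_act : base = setT -> act_invariant c fiber.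
Proof.
have [D1 DM DV] := D_sub => DT g a Da; have [b Db] : base g by rewrite DT.
by rewrite /fiber /mkset -(ext_conj c a g b); apply: (DM _ _ (DM _ _ Db Da)); exact: DV.
Qed.

Lemma fiber_diff a b g : D (a, g) -> D (b, g) -> fiber (a - b).
Proof.
have [D1 DM DV] := D_sub => Da Db.
by rewrite /fiber /mkset -(ext_fiber c a b g); apply: (DM _ _ Da); exact: DV.
Qed.

Lemma fiber_base_full : fiber = setT -> base = setT -> D = setT.
Proof.
have [D1 DM DV] := D_sub => fT bT; apply/seteqP; split=> // -[a g] _.
have [b Db] : base g by rewrite bT.
have Dab : fiber (a - b) by rewrite fT.
by have := DM _ _ Dab Db; rewrite ext_incl_mul /= subrK.
Qed.

End Sub.

Lemma base_tset (K : Type) (D : set E) : monster K N -> finite_set C ->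
  tset D -> tset (base D).
Proof.
move=> N_monster C_finite tD.
have dswap : dmap (fun p : G * A => ((p.2, p.1) : E)).
  exact: dmap_coord (coord_pair coord_snd coord_fst).
have tP := tset_preim dswap tD.
by have := tset_ex N_monster C_finite tP.
Qed.

Lemma conjugate_add s (a a' b b' : A) : aut_fixing C s ->
  conjugate s a a' -> conjugate s b b' -> conjugate s (a + b) (a' + b').
Proof.
move=> sC ca cb; have cab : conjugate s (a, b) (a', b') by apply/conjugate_pair.
exact: (conjugate_dmap dmap_add sC cab).
Qed.

Section Coefficients.
Context (A0 : set A).
Hypotheses (A0_sub : add_subgroup A0) (A0_act : act_invariant c A0)
  (A0_coc : forall g k, A0 (coc c g k))
  (A0_fixed : forall s a, aut_fixing C s -> A0 a -> conjugate s a a).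

Section Thick.
Context (H : set A) (Q : set G).
Hypotheses (H_sub : add_subgroup H) (H_act : act_invariant c H) (Q_sub : subgroup Q).

(** The first coordinate of a quotient of [(a, g)] and [(b, k)] is the image of
    [b - a] under the action, up to an element of [A0]; a code for [H] on the first
    coordinates and one for [Q] on the second ones are therefore enough. *)
Lemma thick_code : (exists phi : A -> set (symbols L),
    forall a b, phi a = phi b -> H (b - a)) ->
  coded_index L Q -> coded_index L (thick (c := c) A0 H Q).
Proof.
move=> [phi phiP] [psi psiP]; have [q q_inj] := set_pairing L.
exists (fun x => q (phi x.1) (psi x.2)) => -[a g] [b k] /= /q_inj[/phiP Hab /psiP Qgk].
exact: thick_ldiv.
Qed.

Lemma thick_invset : invset H -> invset Q -> invset (thick (c := c) A0 H Q).
Proof.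
move=> iH iQ s [a g] [a' g'] sC /conjugate_pair[/= ca cg] [/= Qg [a0 A0a Ha]].
split; first exact: iQ cg Qg.
exists a0 => //=; apply: (iH s _ _ sC _ Ha).
 exact: conjugate_add sC ca (A0_fixed sC A0a).
Qed.

End Thick.

(** A subgroup [D] of the extension that projects onto [Q], with fibre inside [H],
    picks over each [g] in [Q] one class modulo [H]. Comparing products in [D] shows
    that the opposite class, represented in [A0], splits the cocycle. It is an
    invariant function of [g] because [D] and [H] are invariant and the points of
    [A0] are fixed. *)
Lemma subgroup_splitting (H : set A) (Q : set G) (D : set E) :
  add_subgroup H -> act_invariant c H -> invset H -> subgroup Q ->
  subgroup D -> invset D -> fiber D `<=` H ->
  (forall g, Q g -> exists2 a, D (a, g) & exists2 a0, A0 a0 & H (a + a0)) ->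
  ~ nonsplit C emb emb c Q A0 H.
Proof.
move=> H_sub H_act iH Q_sub D_sub iD DH DQ; apply; rewrite /invariant_fun.
have [A00 A0D A0N] := A0_sub; have [H0 HD HN] := H_sub.
have [Q1 QM QV] := Q_sub; have [D1 DM DV] := D_sub.
pose f g : set A := [set x | A0 x /\ exists2 a, D (a, g) & H (a + x)].
have fE g a u : D (a, g) -> A0 u -> H (a + u) -> f g = qclass A0 H u.
  move=> Da A0u Hau; apply/seteqP; split=> [x [A0x [b Db Hbx]]|_ [y [Hy A0y] <-]].
    exists (x - u); last by rewrite addrC subrK.
    split; last by apply: (A0D _ _) => //; exact: A0N.
    have -> : x - u = (b + x) - (a + u) + (a - b).
      by rewrite opprD [b + x + _]addrACA [RHS]addrAC [b - a + _]addrA subrK subrr add0r.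
    apply: (HD _ _); last exact/DH/(fiber_diff D_sub Da Db).
    by apply: (HD _ _) => //; exact: HN.
  split; first exact: A0D.
  by exists a => //; rewrite addrA; exact: HD.
exists f.
  have half s g g' x : aut_fixing C s -> conjugate s g g' -> f g x -> f g' x.
    move=> sC cg [A0x [a Da Hax]]; split=> //.
    have [a' ca] := conjugate_exists a sC.
    exists a'; first by apply: (iD s _ _ sC _ Da); apply/conjugate_pair.
    apply: (iH s _ _ sC _ Hax).
    exact: conjugate_add sC ca (A0_fixed sC A0x).
  move=> s sC g g' _ _ cg.
  have [s' [s'C sK s'K]] := aut_fixing_inv sC.
  apply/seteqP; split=> [_ [x fx <-]|_ [_ [x fx <-] <-]].
    have fgx := half _ _ _ _ s'C (conjugateV sK cg) fx.
    exists (emb x); first by exists x.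
    by case: fx => /(A0_fixed sC).
  have := half _ _ _ _ sC cg fx; exists x => //.
  by case: fx => /(A0_fixed sC).
split.
- move=> g Qg; have [a Da [u A0u Hau]] := DQ _ Qg.
  by rewrite (fE _ _ _ Da A0u Hau); exists u.
- by apply: (fE _ 0); rewrite ?addr0.
- move=> g1 g2 Qg1 Qg2.
  have [a1 D1a [u1 A0u1 H1]] := DQ _ Qg1.
  have [a2 D2a [u2 A0u2 H2]] := DQ _ Qg2.
  pose k := coc c g1 g2.
  have D12 : D (a1 + act c g1 a2 + k, (g1 * g2)%g) by exact: DM _ _ D1a D2a.
  (* The value of the splitting at [g1 * g2], read off the product in [D]. *)
  pose u12 := u1 + act c g1 u2 - k.
  have A0u12 : A0 u12.
    by apply: (A0D _ _ _ (A0N _ (A0_coc g1 g2))); apply: (A0D _ _) => //; exact: A0_act.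
  have H12 : H (a1 + act c g1 a2 + k + u12).
    rewrite /u12 addrACA subrr addr0 addrACA -actD; apply: (HD _ _) => //; exact: H_act.
  rewrite (fE _ _ _ D1a A0u1 H1) (fE _ _ _ D2a A0u2 H2) (fE _ _ _ D12 A0u12 H12).
  apply/seteqP; split.
    move=> _ [x [Hx A0x] <-]; exists (u1 + act c g1 u2 + x), u12; split.
    + exists (u1 + x), (act c g1 u2); split; last by rewrite addrAC.
        by exists x.
      by exists u2 => //; exists 0; rewrite ?addr0.
    + by exists 0; rewrite ?addr0.
    + by rewrite /u12 opprB [u1 + _ + x]addrC addrACA subrr addr0 addrC.
  move=> _ [_ [_ [[_ [_ [[x1 [Hx1 A0x1] <-] [_ [x2 [Hx2 A0x2] <-] <-] ->]]]
    [x3 [Hx3 A0x3] <-] ->]]].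
  exists (x1 + act c g1 x2 - x3).
    split.
      by apply: (HD _ _ _ (HN _ Hx3)); apply: (HD _ _) => //; exact: H_act.
    by apply: (A0D _ _ _ (A0N _ A0x3)); apply: (A0D _ _) => //; exact: A0_act.
  by rewrite actD /u12 addrACA opprD opprB [RHS]addrACA [_ + (k - _)]addrC subrK.
Qed.

End Coefficients.
End DefinableExtension.

(** * The components of the extension *)

Section Components.
Import GRing.Theory.
Local Open Scope ring_scope.
Context (K : Type) (L : language) (N : structure L) (C : set N).
Hypotheses (N_monster : monster K N) (C_finite : finite_set C).
Context (G : groupType) (A : zmodType) (c : cocycle_action G A).
Context {sG : dsort C G} {sA : dsort C A}.
Local Notation E := (extension c).
Hypotheses (dmap_mul : dmap (fun p : G * G => (p.1 * p.2)%g))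
  (dmap_add : dmap (fun p : A * A => p.1 + p.2))
  (dmap_act : dmap (fun p : G * A => act c p.1 p.2))
  (dmap_coc : dmap (fun p : G * G => coc c p.1 p.2)).
Context (A0 : set A) (e : nat -> A).
Hypotheses (A0_sub : add_subgroup A0) (A0_act : act_invariant c A0)
  (A0_coc : forall g k, A0 (coc c g k))
  (A0_fixed : forall s a, aut_fixing C s -> A0 a -> conjugate s a a)
  (A0_countable : forall a, A0 a -> exists n, a = e n).

Lemma qclass_eq0 (H : set A) a : add_subgroup H -> A0 a ->
  qclass A0 H a = qclass A0 H 0 <-> H a.
Proof.
have [A00 A0D A0N] := A0_sub; move=> [H0 HD HN] A0a; split=> [qa|Ha].
  have : qclass A0 H 0 a by rewrite -qa; exists 0; rewrite ?addr0.
  by move=> [x [Hx _] <-]; rewrite add0r.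
apply/seteqP; split=> [_ [x [Hx A0x] <-]|_ [x [Hx A0x] <-]].
  by exists (a + x); rewrite ?add0r //; split; [exact: HD|exact: A0D].
exists (- a + x).
  by split; [apply: (HD _ _) => //; exact: HN|apply: (A0D _ _) => //; exact: A0N].
by rewrite add0r addrA subrr add0r.
Qed.

Local Notation G00 := (comp00 K C (@emb _ _ _ _ sG)).
Local Notation G000 := (comp000 K C (@emb _ _ _ _ sG)).
Local Notation E00 := (comp00 K C (@emb _ _ _ E (@extension_sort L N C G A c sG sA))).
Local Notation E000 := (comp000 K C (@emb _ _ _ _ (@extension_sort L N C G A c sG sA))).

Let G_ldiv := dmap_base_ldiv dmap_mul.
Let A_sub := dmap_fiber_sub dmap_add.
Let E_ldiv := dmap_ext_ldiv dmap_mul dmap_add dmap_act dmap_coc.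
Let G00P := comp00P N_monster C_finite G_ldiv.
Let E00P := comp00P N_monster C_finite E_ldiv.

(** The projection of [E00] to [G] is type-definable of bounded index. *)
Lemma G00_base : G00 `<=` base E00.
Proof.
have [D_sub D_coded D_t] := E00P.
apply: (comp00_sub N_monster); first exact: base_subgroup.
  exact: base_code.
exact: base_tset N_monster C_finite D_t.
Qed.

Lemma comp000_neq_comp00 (A1 : set A) : add_subgroup A1 -> add_bounded_index K A1 ->
  tset A1 -> act_invariant c A1 -> nonsplit C emb emb c G00 A0 A1 ->
  quotient_torsion_free A0 A1 -> E000 <> E00.
Proof.
move=> A1_sub A1_bd A1_t A1_act ns tf E0.
have [D_sub D_coded D_t] := E00P; have [Q_sub Q_coded Q_t] := G00P.
have [A00 A0D A0N] := A0_sub; have [A10 A1D A1N] := A1_sub.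
have A1_code := add_bounded_index_code N_monster C_finite A_sub A1_sub A1_bd A1_t.
have A1_inv := tset_invset A1_t.
have D_thick : E00 `<=` thick (c := c) A0 A1 G00.
  rewrite -E0; apply: (comp000_sub N_monster).
  - exact: thick_subgroup.
  - exact: thick_code.
  - by apply: thick_invset => //; exact: tset_invset.
have fiber_A1 : fiber E00 `<=` A1.
  apply: (torsion_free_countable_cosets N_monster C_finite A_sub A1_sub A1_bd A1_t
    (e := e)).
  - exact: fiber_subgroup.
  - exact: fiber_tset.
  - move=> a Da; have [_ [a0 A0a0 Ha]] := D_thick _ Da.
    have [n en] := A0_countable (A0N _ A0a0).
    by exists n; rewrite -en opprK.
  - move=> a m Da m0 Ham; have [_ [a0 A0a0 Ha]] := D_thick _ Da.
    have X b i : A1 b -> A1 (b *+ i).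
      by move=> Ab; elim: i => [|i IH]; rewrite ?mulr0n // mulrS; exact: A1D.
    have X0 b i : A0 b -> A0 (b *+ i).
      by move=> Ab; elim: i => [|i IH]; rewrite ?mulr0n // mulrS; exact: A0D.
    have A1a0 : A1 a0.
      apply/(qclass_eq0 A1_sub A0a0); apply: (tf _ _ A0a0 m0).
      apply/(qclass_eq0 A1_sub (X0 _ m A0a0)).
      have -> : a0 *+ m = (a + a0) *+ m - a *+ m by rewrite mulrnDl addrC addKr.
      by apply: (A1D _ _ (X _ _ Ha)); exact: A1N.
    have -> : a = (a + a0) - a0 by rewrite addrK.
    by apply: (A1D _ _ Ha); exact: A1N.
apply: (subgroup_splitting dmap_add A0_sub A0_act A0_coc A0_fixed A1_sub A1_act
  A1_inv Q_sub D_sub (tset_invset D_t) fiber_A1 _ ns).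
move=> g Qg; have [a Da] := G00_base Qg; exists a => //.
by have [] := D_thick _ Da.
Qed.

(** The fibre of [E00] is one of the subgroups [H] of the hypothesis unless it is the
    whole of [A]. The values needed for a splitting modulo the fibre lie in [A0]
    because the elements of [E00] whose first coordinate is in [A0] modulo the fibre
    project to an invariant subgroup of bounded index, that is, to [G]. *)
Lemma comp00_full : G000 = [set: G] ->
  (forall H : set A, add_subgroup H -> H <> [set: A] -> add_bounded_index K H ->
     type_definable C (emb @` H) -> act_invariant c H ->
     nonsplit C emb emb c [set: G] A0 H) ->
  E00 = [set: E].
Proof.
move=> GT ns.
have [D_sub D_coded D_t] := E00P; have [Q_sub Q_coded Q_t] := G00P.
have [A00 A0D A0N] := A0_sub.
have QT : G00 = [set: G].
  apply/seteqP; split=> // g _; apply: (comp000_comp00 N_monster C_finite G_ldiv).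
  by rewrite GT.
have DT : base E00 = [set: G].
  by apply/seteqP; split=> // g _; apply: G00_base; rewrite QT.
have P_sub := fiber_subgroup D_sub.
have P_act := fiber_act D_sub DT.
have P_t : tset (fiber E00) by exact: fiber_tset.
have [phi phiP] := fiber_code D_coded.
have P_inv := tset_invset P_t.
have [PT|PnT] := pselect (fiber E00 = setT); first exact: fiber_base_full.
have P_bd : add_bounded_index K (fiber E00).
  have [_ Psym Ptrans] := add_equivalence P_sub.
  apply: (small_range (phi := phi) _ (small_symbols N_monster)) => x y /phiP Pxy.
  rewrite !add_cosetE; apply/seteqP; split=> z /= Pz.
    exact: (Ptrans y x z (Psym x y Pxy) Pz).
  exact: (Ptrans x y z Pxy Pz).
have T_sub : subgroup [set: G] by [].
have T_code : coded_index L [set: G] by exists (fun=> set0).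
have th_sub := thick_subgroup A0_sub A0_act A0_coc P_sub P_act T_sub.
have th_inv : invset (thick (c := c) A0 (fiber E00) setT).
  by apply: thick_invset => // s g g' _ _ _.
have [D1 DM DV] := D_sub; have [S1 SM SV] := th_sub.
pose Dt : set E := E00 `&` thick (c := c) A0 (fiber E00) setT.
have Dt_sub : subgroup Dt.
  split; first by [].
    by move=> x y [Dx Sx] [Dy Sy]; split; [exact: DM|exact: SM].
  by move=> x [Dx Sx]; split; [exact: DV|exact: SV].
have Dt_base : G000 `<=` base Dt.
  apply: (comp000_sub N_monster); first exact: base_subgroup.
    have /choice[l lP] : forall g, exists a, E00 (a, g).
      by move=> g; have [a Da] : base E00 g; [rewrite DT|exists a].
    exists (fun g => phi (l g)) => g k /phiP Plk.
    exists (((l g, g) : E)^-1 * ((l k, k) : E))%g.1; split.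
      exact: DM (DV _ (lP g)) (lP k).
    exact: thick_ldiv.
  move=> s g g' sC cg [a [Da Sa]]; have [a' ca] := conjugate_exists a sC.
  have cag : conjugate s (a, g) (a', g') by apply/conjugate_pair.
  exists a'; split; first exact: (tset_invset D_t sC cag Da).
  exact: (th_inv _ _ _ sC cag Sa).
have P_td : type_definable C (emb @` fiber E00) by exact/tset_type_definable.
exfalso; apply: (subgroup_splitting dmap_add A0_sub A0_act A0_coc A0_fixed P_sub P_act
  P_inv T_sub D_sub (tset_invset D_t) _ _ (ns _ P_sub PnT P_bd P_td P_act)) => // g _.
by have [|a [Da [_ Sa]]] := Dt_base g; [rewrite GT|exists a].
Qed.

End Components.

(** * From the structure to its elementary extension *)

Section GeneratedSubgroup.
Import GRing.Theory.
Local Open Scope ring_scope.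
Context (A : zmodType).

Lemma generated_subgroup (F : set A) : add_subgroup (smallest (@add_subgroup A) F).
Proof.
split.
- by move=> S [[]].
- by move=> x y Sx Sy S SP; have [[_ SD _] _] := SP; apply: (SD _ _ (Sx _ SP) (Sy _ SP)).
- by move=> x Sx S SP; have [[_ _ SN] _] := SP; apply: (SN _ (Sx _ SP)).
Qed.

Lemma generated_countable (F : set A) : finite_set F ->
  exists e : nat -> A, forall a, smallest (@add_subgroup A) F a -> exists n, a = e n.
Proof.
move=> /finite_seqP[s ->].
pose t (x : bool * nat) := if x.1 then - s`_x.2 else s`_x.2.
pose v (l : seq (bool * nat)) := \sum_(x <- l) t x.
exists (fun n => v (odflt [::] (unpickle n))).
suff sub : smallest (@add_subgroup A) [set` s] `<=` range v.
  by move=> a /sub[l _ <-]; exists (pickle l); rewrite pickleK.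
apply: smallest_sub.
  split; first by exists [::] => //; rewrite /v big_nil.
    by move=> _ _ [l _ <-] [l' _ <-]; exists (l ++ l') => //; rewrite /v big_cat.
  move=> _ [l _ <-]; exists [seq (~~ x.1, x.2) | x <- l] => //.
  rewrite /v big_map -sumrN; apply: eq_bigr => -[[] i] _ //=; by rewrite opprK.
move=> a /= /(nthP 0)[i _ <-]; exists [:: (false, i)] => //.
by rewrite /v big_seq1.
Qed.

End GeneratedSubgroup.

Lemma dmap_op_graph (L : language) (N : structure L) (C : set N) (X Y Z : Type)
    {sX : dsort C X} {sY : dsort C Y} {sZ : dsort C Z} (op : X -> Y -> Z) :
  definable C (op_graph (@emb _ _ _ _ sX) (@emb _ _ _ _ sY) (@emb _ _ _ _ sZ) op) ->
  dmap (fun p : X * Y => op p.1 p.2).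
Proof.
move=> dop.
have dg : dset [set q : X * (Y * Z) | op q.1 q.2.1 = q.2.2].
  move: dop; congr definable; apply/seteqP.
  split=> [_ [x [y ->]]|_ [[x [y z]] /= <- <-]].
    by exists (x, (y, op x y)).
  by exists x, y.
have c : coordinate_map (fun p : X * Y * Z => (p.1.1, (p.1.2, p.2))).
  apply: coord_pair (coord_comp coord_fst coord_fst) _.
  exact: coord_pair (coord_comp coord_fst coord_snd) coord_snd.
exact: dset_coord c dg.
Qed.

Section Transfer.
Context (L : language) (M N : structure L) (j : M -> N) (B : set M).
Hypothesis j_elem : elementary j.

Definition lifts (X X' : Type) n (i : X -> tup M n) (i' : X' -> tup N n)
  (x : X) (x' : X') : Prop := i' x' = j \o i x.

Lemma lifts_exists (X X' : Type) n (i : X -> tup M n) (i' : X' -> tup N n) x :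
  interpreted j B (range i) (range i') -> exists x', lifts i i' x x'.
Proof.
move=> hX; have [h _] := interpreted_mem j_elem (i x) hX.
by have [|x' _ ex] := h _; [exists x|exists x'].
Qed.

Lemma lifts_op (X X' Y Y' Z Z' : Type) n m k
    (i : X -> tup M n) (i' : X' -> tup N n) (l : Y -> tup M m) (l' : Y' -> tup N m)
    (r : Z -> tup M k) (r' : Z' -> tup N k) op op' x x' y y' :
  injective i' -> injective l' ->
  interpreted j B (op_graph i l r op) (op_graph i' l' r' op') ->
  lifts i i' x x' -> lifts l l' y y' -> lifts r r' (op x y) (op' x' y').
Proof.
move=> i_inj l_inj hop hx hy.
have [h _] := interpreted_mem j_elem (tcat (i x) (tcat (l y) (r (op x y)))) hop.
have [|u [v]] := h _; first by exists x, y.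
rewrite !comp_tcat -hx -hy => /tcat_inj[/i_inj <- /tcat_inj[/l_inj <- hr]].
exact: esym hr.
Qed.

(** That a formula has at most one solution is a property that an elementary
    embedding preserves. *)
Lemma dcl_interpreted n (t : tup M n) :
  dcl B t -> interpreted j B [set t] [set j \o t].
Proof.
move=> [D oD tD].
have hD : interpreted j B [set t] (realise j D) by exists D.
suff <- : realise j D = [set j \o t] by [].
have Dt : realise j D (j \o t) by apply/(interpreted_mem j_elem t hD).
apply/seteqP; split=> [u Du|_ ->//]; apply: contrapT => ut.
have hl := interpreted_reindex (@lshift n n) hD.
have hr := interpreted_reindex (@rshift n n) hD.
have he := interpreted_eq j B (@lshift n n) (@rshift n n).
have [|v [[/= vl vr] nv]] :=
    interpreted_nonempty j_elem (interpreted_setD (interpreted_setI hl hr) he).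
  exists (tcat u (j \o t)); split; first by split; rewrite /= ?tcat_lshift ?tcat_rshift.
  by rewrite /= tcat_lshift tcat_rshift.
by apply: nv; rewrite /= vl vr.
Qed.

End Transfer.

Section CocycleValues.
Import GRing.Theory.
Local Open Scope ring_scope.
Context (L : language) (M N : structure L) (j : M -> N) (B : set M).
Hypothesis j_elem : elementary j.
Context (G G' : groupType) (A A' : zmodType) (n k : nat)
  (iG : G -> tup M n) (iA : A -> tup M k) (iG' : G' -> tup N n) (iA' : A' -> tup N k)
  (h : cocycle_action G A) (h' : cocycle_action G' A').
Hypotheses (iG'_inj : injective iG') (iA'_inj : injective iA').
Hypotheses
  (G_range : interpreted j B (range iG) (range iG'))
  (A_range : interpreted j B (range iA) (range iA'))
  (A_add : interpreted j B (op_graph iA iA iA (fun x y => x + y))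
                           (op_graph iA' iA' iA' (fun x y => x + y)))
  (h_coc : interpreted j B (op_graph iG iG iA (coc h)) (op_graph iG' iG' iA' (coc h'))).
Hypotheses (h_finite : finite_set (coc_image h))
  (h_dcl : iA @` coc_image h `<=` dcl B (n := k)).

Local Notation S := (smallest (@add_subgroup A) (coc_image h)).
Local Notation A0 := (lift_set j iA iA' S).
Local Notation liftsA := (lifts j iA iA').

Lemma lifts_fun a x y : liftsA a x -> liftsA a y -> x = y.
Proof. by move=> ax ay; apply: iA'_inj; rewrite ax ay. Qed.

Lemma lifts_add a b a' b' : liftsA a a' -> liftsA b b' -> liftsA (a + b) (a' + b').
Proof. exact: lifts_op A_add. Qed.

Lemma lifts0 : liftsA 0 0.
Proof.
have [z hz] := lifts_exists j_elem 0 A_range.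
have := lifts_add hz hz; rewrite addr0 => hzz.
have zz := lifts_fun hzz hz.
by have <- : z = 0 by apply: (addrI z); rewrite zz addr0.
Qed.

Lemma lifts_opp a a' : liftsA a a' -> liftsA (- a) (- a').
Proof.
move=> ha; have [b hb] := lifts_exists j_elem (- a) A_range.
have := lifts_add ha hb; rewrite subrr => h0.
have ab := lifts_fun h0 lifts0.
by have <- : b = - a' by apply: (addrI a'); rewrite ab subrr.
Qed.

Lemma lift_set_subgroup : add_subgroup A0.
Proof.
have [S0 SD SN] := generated_subgroup (coc_image h); split.
- by exists 0 => //; exact: lifts0.
- by move=> a' b' [a Sa ha] [b Sb hb]; exists (a + b); [exact: SD|exact: lifts_add].
- by move=> a' [a Sa ha]; exists (- a); [exact: SN|exact: lifts_opp].
Qed.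

(** Induction over [A0]: lifting is additive, so a subgroup containing the lifts of
    the generators contains [A0]. *)
Lemma lift_set_sub (T : set A') : add_subgroup T ->
  (forall a a', coc_image h a -> liftsA a a' -> T a') -> A0 `<=` T.
Proof.
move=> [T0 TD TN] hT a' [a Sa ha].
suff sub : S `<=` [set a | forall a', liftsA a a' -> T a'] by exact: sub Sa _ ha.
apply: smallest_sub => [|x /hT]; last by move=> hx y; exact: hx.
split=> [x hx|x y Tx Ty z hz|x Tx z hz].
- by rewrite (lifts_fun hx lifts0).
- have [x' hx] := lifts_exists j_elem x A_range.
  have [y' hy] := lifts_exists j_elem y A_range.
  by rewrite (lifts_fun hz (lifts_add hx hy)); exact: TD (Tx _ hx) (Ty _ hy).
- have [x' hx] := lifts_exists j_elem x A_range.
  by rewrite (lifts_fun hz (lifts_opp hx)); exact: TN (Tx _ hx).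
Qed.

(** The image of the cocycle does not grow in the elementary extension: no value
    differs from each of the finitely many points of the image, which are definable. *)
Lemma lifts_coc g1 g2 : exists2 a, coc_image h a & liftsA a (coc h' g1 g2).
Proof.
have [s sE] := (finite_seqP _).1 h_finite.
apply: contrapT => no.
pose val3 T (t : tup T (n + (n + k))) : tup T k :=
  t \o (@rshift n (n + k) \o @rshift n k).
have val3E T (u v : tup T n) (w : tup T k) : val3 T (tcat u (tcat v w)) = w.
  by rewrite /val3 compA tcat_rshift tcat_rshift.
have avoid : forall l : seq A, {subset l <= s} -> interpreted j B
    [set t | op_graph iG iG iA (coc h) t /\ forall a, a \in l -> val3 M t <> iA a]
    [set t | op_graph iG' iG' iA' (coc h') t /\
       forall a, a \in l -> val3 N t <> j \o iA a].
  elim=> [|a l IH] ls.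
    have E T (X : set (tup T (n + (n + k)))) (f : A -> tup T k) :
        [set t | X t /\ forall a, a \in [::] -> val3 T t <> f a] = X.
      by apply/seteqP; split=> [t []|t].
    by rewrite (E _ _ iA) (E _ _ (fun a => j \o iA a)).
  have ha : interpreted j B [set iA a] [set j \o iA a].
    apply: dcl_interpreted => //; apply: h_dcl; exists a => //.
    by rewrite sE /=; apply: ls; rewrite inE eqxx.
  have hal := interpreted_setD (IH (fun x xl => ls x (mem_behead (s := a :: l) xl)))
    (interpreted_reindex (@rshift n (n + k) \o @rshift n k) ha).
  have E T (X : set (tup T (n + (n + k)))) (f : A -> tup T k) :
     [set t | X t /\ forall a, a \in l -> val3 T t <> f a] `\`
       [set t : tup T (n + (n + k)) |
          [set f a] (t \o (@rshift n (n + k) \o @rshift n k))] =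
     [set t | X t /\ forall b, b \in a :: l -> val3 T t <> f b].
    apply/seteqP; split=> [t [[Xt tl] ta]|t [Xt tl]].
      by split=> // b; rewrite inE => /predU1P[->|/tl].
    split; last by apply: tl; rewrite inE eqxx.
    by split=> // b bl; apply: tl; rewrite inE bl orbT.
  by move: hal; rewrite (E _ _ iA) (E _ _ (fun a => j \o iA a)).
have [|t [[x [y ->]] ht]] := interpreted_nonempty j_elem (avoid s (fun _ => id)).
  exists (tcat (iG' g1) (tcat (iG' g2) (iA' (coc h' g1 g2)))).
  split=> [|a sa]; first by exists g1, g2.
  by rewrite val3E => e; apply: no; exists a => //; rewrite sE.
apply: (ht (coc h x y)); last by rewrite val3E.
have : coc_image h (coc h x y) by exists x, y.
by rewrite sE.
Qed.

Lemma lift_set_coc g1 g2 : A0 (coc h' g1 g2).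
Proof.
by have [a ha la] := lifts_coc g1 g2; exists a => //; exact: sub_gen_smallest.
Qed.

(** The cocycle identity expresses the image of a value under the action by three
    other values. *)
Lemma lift_set_act : act_invariant h' A0.
Proof.
have [A00 A0D A0N] := lift_set_subgroup.
move=> g; apply: (lift_set_sub (T := [set a' | A0 (act h' g a')])).
  split=> [|x y Tx Ty|x Tx]; rewrite /mkset ?act0 ?actD ?actN //.
    exact: A0D.
  exact: A0N.
move=> _ a' [g1 [g2 ->]] ha.
have [g1' hg1] := lifts_exists j_elem g1 G_range.
have [g2' hg2] := lifts_exists j_elem g2 G_range.
have hc := lifts_op j_elem iG'_inj iG'_inj h_coc hg1 hg2.
rewrite /mkset (lifts_fun ha hc).
have -> : act h' g (coc h' g1' g2') =
    coc h' g g1' + coc h' (g * g1')%g g2' - coc h' g (g1' * g2')%g.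
  by rewrite coc_eq [X in X - _]addrC addrK.
apply: (A0D _ _ (A0D _ _ _ _) (A0N _ _)); exact: lift_set_coc.
Qed.

Lemma lift_set_countable : exists e : nat -> A', forall a, A0 a -> exists i, a = e i.
Proof.
have [e eP] := generated_countable h_finite.
have /choice[f fP] : forall i, exists a', liftsA (e i) a'.
  by move=> i; exact: (lifts_exists j_elem (e i) A_range).
exists f => a' [a /eP[i ->] ha]; exists i.
exact: lifts_fun ha (fP i).
Qed.

Definition fiber_sort : dsort (j @` B) A' :=
  DSort iA'_inj (interpreted_definable A_range).

Lemma dmap_fiber_add : @dmap _ _ _ _ _ (prod_sort fiber_sort fiber_sort) fiber_sort
  (fun p : A' * A' => p.1 + p.2).
Proof.
apply: (dmap_op_graph (sX := fiber_sort) (sY := fiber_sort) (sZ := fiber_sort)).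
exact: interpreted_definable A_add.
Qed.

Lemma lift_set_fixed s a' : aut_fixing (j @` B) s -> A0 a' ->
  conjugate (sX := fiber_sort) s a' a'.
Proof.
move=> sC; pose sA := fiber_sort.
apply: (lift_set_sub (T := [set a' | conjugate (sX := sA) s a' a'])).
  have add := conjugate_add dmap_fiber_add sC.
  have c0 : conjugate (sX := sA) s (0 : A') 0.
    have [z cz] := conjugate_exists (sX := sA) (0 : A') sC.
    have := add _ _ _ _ cz cz; rewrite addr0 => czz.
    have zz := conjugate_fun czz cz.
    have z0 : z = 0 by apply: (addrI z); rewrite zz addr0.
    by rewrite z0 in cz.
  split=> // [x y cx cy|x cx]; first exact: add.
  have [z cz] := conjugate_exists (sX := sA) (- x) sC.
  have := add _ _ _ _ cx cz; rewrite subrr => cxz.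
  have xz := conjugate_fun cxz c0.
  have zx : z = - x by apply: (addrI x); rewrite xz subrr.
  by rewrite zx in cz.
move=> a x ca ax; rewrite /mkset /conjugate /= ax.
have ha : interpreted j B [set iA a] [set j \o iA a].
  by apply: dcl_interpreted => //; apply: h_dcl; exists a.
have [_ h1] := definable_automorphism (j \o iA a) sC (interpreted_definable ha).
by rewrite -[LHS]h1.
Qed.
End CocycleValues.

Unset Implicit Arguments.
Set Strict Implicit.

Theorem theorem2p2
  (L : language) (M N : structure L) (j : M -> N) (K : Type)
  (B : set M)
  (G G' : groupType) (A A' : zmodType) (n k : nat)
  (iG : G -> tup M n) (iA : A -> tup M k)
  (iG' : G' -> tup N n) (iA' : A' -> tup N k)
  (h : cocycle_action G A) (h' : cocycle_action G' A')
  (A1 : set A')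
  (j_elementary : elementary j)
  (N_monster : monster K N)
  (B_finite : finite_set B)
  (h_interpreted : interpreted_cocycle j B iG iA iG' iA' h h')
  (h_finite : finite_set (coc_image h))
  (h_dcl : iA @` coc_image h `<=` dcl B (n := k))
  (A1_subgroup : add_subgroup A1)
  (A1_bounded : add_bounded_index K A1)
  (A1_tdef : type_definable (j @` B) (iA' @` A1))
  (A1_inv : act_invariant h' A1) :
  let B' : set N := j @` B in
  let A0 : set A' :=
    lift_set j iA iA' (smallest (@add_subgroup A) (coc_image h)) in
  let iE : extension h' -> tup N (k + n) := ext_tup iG' iA' (c := h') in
  nonsplit B' iG' iA' h' (comp00 K B' iG') A0 A1 ->
  quotient_torsion_free A0 A1 ->
  comp000 K B' iE <> comp00 K B' iE
  /\ (comp000 K B' iG' = [set: G'] ->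
      (forall H : set A',
         add_subgroup H -> H <> [set: A'] -> add_bounded_index K H ->
         type_definable B' (iA' @` H) -> act_invariant h' H ->
         nonsplit B' iG' iA' h' [set: G'] A0 H) ->
      comp00 K B' iE = [set: extension h']).
Proof.
move=> B' A0 iE ns tf.
have [_ [iG'_inj iA'_inj] [[G_dom G_mul] [A_dom A_plus] h_act h_coc]] := h_interpreted.
have B0 : set0 `<=` B by [].
have G_range := interpreted_sub B0 G_dom.
have A_range := interpreted_sub B0 A_dom.
have A_add := interpreted_sub B0 A_plus.
pose sG : dsort B' G' := DSort iG'_inj (interpreted_definable G_range).
pose sA : dsort B' A' := fiber_sort iA'_inj A_range.
have C_finite : finite_set B' by exact: finite_image.
have dmul : dmap (fun p : G' * G' => (p.1 * p.2)%g).
  apply: (dmap_op_graph (sX := sG) (sY := sG) (sZ := sG)).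
  exact: interpreted_definable (interpreted_sub B0 G_mul).
have dact : dmap (fun p : G' * A' => act h' p.1 p.2).
  apply: (dmap_op_graph (sX := sG) (sY := sA) (sZ := sA)).
  exact: interpreted_definable (interpreted_sub B0 h_act).
have dcoc : dmap (fun p : G' * G' => coc h' p.1 p.2).
  apply: (dmap_op_graph (sX := sG) (sY := sG) (sZ := sA)).
  exact: interpreted_definable h_coc.
have dadd : @dmap _ _ _ _ _ (prod_sort sA sA) sA (fun p => p.1 + p.2)%R.
  exact: dmap_fiber_add A_add.
have A0_sub : add_subgroup A0.
  exact: (lift_set_subgroup j_elementary h iA'_inj A_range A_add).
have A0_act : act_invariant h' A0.
  exact: (lift_set_act j_elementary iG'_inj iA'_inj G_range A_range A_add h_coc
    h_finite h_dcl).
have A0_coc g1 g2 : A0 (coc h' g1 g2).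
  exact: (lift_set_coc j_elementary h_coc h_finite h_dcl).
have A0_fixed s a : aut_fixing B' s -> A0 a -> conjugate s a a.
  exact: (lift_set_fixed j_elementary iA'_inj A_range A_add h_dcl).
have [e eP] : exists e : nat -> A', forall a, A0 a -> exists i, a = e i.
  exact: (lift_set_countable j_elementary iA'_inj A_range h_finite).
have A1_t : tset A1 by exact/tset_type_definable.
split.
  exact: (comp000_neq_comp00 N_monster C_finite dmul dadd dact dcoc A0_sub A0_act
    A0_coc A0_fixed eP A1_subgroup A1_bounded A1_t A1_inv ns tf).
exact: (comp00_full N_monster C_finite dmul dadd dact dcoc A0_sub A0_act A0_coc
  A0_fixed).
Qed.
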